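(* Let $a<0<b$ be real numbers, let $w$ be a standard Brownian motion started at $0$, let $\tau$ be the first time $w$ equals $a$ or $b$, and let $L_0$ be the Lévy local time of $w$ at $0$. Then for every $\gamma>0$, $$\mathsf E_0\,e^{-\gamma L_0(\tau)}=\frac{1}{1+\frac{2(-a)b}{b-a}\gamma};$$ that is, $L_0(\tau)$ is exponentially distributed with mean $\frac{2(-a)b}{b-a}$. In particular, if $a=-b$, the mean equals $b$.
   Context: $\mathsf E_0$ denotes expectation for the Brownian motion started at $0$. The local time is normalized as the occupation density with respect to Lebesgue measure: almost surely, for each $t\ge 0$, $L_0(t)=\lim_{\delta\to0+}\frac1{2\delta}\int_0^t \mathbf 1_{\{|w(s)|<\delta\}}\,ds$. *)

(* Defs.v *)
From HB Require Import structures.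
From mathcomp Require Import all_boot all_order all_algebra.
From mathcomp Require Import all_classical all_reals all_analysis.
Set Implicit Arguments.
Unset Strict Implicit.
Unset Printing Implicit Defensive.
Import Order.TTheory GRing.Theory Num.Theory.
Import numFieldNormedType.Exports.
Local Open Scope classical_set_scope.
Local Open Scope ring_scope.

(* Mutual independence of a finite family: taking B i = setT for some of the i
   gives the product rule for every subfamily. *)
Definition mutually_independent (d : measure_display) (T : measurableType d)
    (R : realType) (P : probability T R) (n : nat) (X : 'I_n -> T -> R) : Prop :=
  forall B : 'I_n -> set R, (forall i, measurable (B i)) ->
    P (\bigcap_i (X i @^-1` B i)) = (\prod_(i < n) P (X i @^-1` B i))%E.

(* Processes are indexed by all of R; only times t >= 0 are constrained. *)
Record standard_brownian_motion (d : measure_display) (T : measurableType d)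
    (R : realType) (P : probability T R) (w : R -> {RV P >-> R}) : Prop := {
  sbm_start : {ae P, forall x, w 0 x = 0};
  sbm_indep : forall (t : nat -> R) (n : nat), 0 <= t 0%N ->
    (forall i, t i <= t i.+1) ->
    mutually_independent P (fun (i : 'I_n) x => w (t i.+1) x - w (t i) x);
  (* the second parameter of [normal_prob] is the standard deviation *)
  sbm_gauss : forall s t : R, 0 <= s -> s < t ->
    forall B : set R, measurable B ->
    P ((w t \- w s) @^-1` B) = normal_prob 0 (Num.sqrt (t - s)) B;
  sbm_continuous : {ae P, forall x,
    {within `[0, +oo[%classic, continuous (fun t : R => w t x)}}
}.
Arguments standard_brownian_motion {d T R} P w.

(* First time at which w equals a or b; +oo if there is no such time. *)
Definition hitting_time (R : realType) (T : Type) (w : R -> T -> R) (a b : R)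
    (x : T) : \bar R :=
  ereal_inf [set t%:E | t in [set t : R | 0 <= t /\ (w t x = a \/ w t x = b)]].

(* L is the local time of w at 0, as occupation density with respect to
   Lebesgue measure; the exceptional null set does not depend on t. *)
Definition is_local_time0 (d : measure_display) (T : measurableType d)
    (R : realType) (P : probability T R) (w L : R -> T -> R) : Prop :=
  {ae P, forall x, forall t : R, 0 <= t ->
    (2 * delta)^-1 * (\int[lebesgue_measure]_(s in `[0%R, t])
                        \1_[set u : R | `|w u x| < delta] s)
      @[delta --> 0^'+] --> L t x}.

(* X has law mu.  X is only required to be almost surely equal to a random
   variable: quantities defined up to a null set, such as a local time evaluated
   at a random time, need not be measurable when P is not complete. *)
Definition has_law (d : measure_display) (T : measurableType d)
    (R : realType) (P : probability T R) (X : T -> R)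
    (mu : set R -> \bar R) : Prop :=
  exists2 Y : {RV P >-> R}, {ae P, forall x, Y x = X x} &
    forall B : set R, measurable B -> distribution P Y B = mu B.

(* Main.v *)
Require Import Defs.
From HB Require Import structures.
From mathcomp Require Import all_boot all_order all_algebra.
From mathcomp Require Import all_classical all_reals all_analysis.
From mathcomp Require Import measurable_realfun.
From mathcomp Require Import ring lra.
Import Order.TTheory GRing.Theory Num.Theory.
Import numFieldNormedType.Exports.
Local Open Scope classical_set_scope.
Local Open Scope ring_scope.
Set Implicit Arguments.
Unset Strict Implicit.

(* Ito-Tanaka and Stein's method.  Put [phi x = x / b] for [x > 0] and
   [phi x = x / a] for [x < 0], so that [phi a = phi b = 1] and
   [phi (w t) - L t / m] is a martingale with [m = 2 (-a) b / (b - a)].  Since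
   [L] grows only where [phi (w t) = 0], for every test function [K] vanishing
   at 0, with derivative [H], the process [phi (w t) H (L t) - K (L t) / m] is a
   martingale; stopping it at [tau] gives Stein's equation of the exponential law,
     E [H (L tau) - K (L tau) / m] = 0,
   which determines the Laplace transform and the tail of [L tau].

   Stochastic calculus is avoided by discretization.  [phi] is replaced by a C^2
   function whose second derivative is [2 / m] times a Lipschitz kernel
   approximating the Dirac mass at 0, and [w] by the random walk of its
   increments on a grid, stopped when it leaves an interval slightly smaller
   than (a, b): its exit time is then squeezed below [tau] and above the last
   zero of [w] before [tau].  A Taylor expansion with Gaussian increments gives
   the martingale property up to an error vanishing with the mesh, and one lets
   first the mesh and then the kernel width go to 0. *)

(** * Smoothed kernels *)

(** Four obstacles shape the details. A Gaussian step can leave (a, b) by any amount, so the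
    smoothed [phi] is also clamped to a bounded interval; the cubic Taylor error absorbs the long
    steps on which the clamp acts. The smoothed [phi] is not zero where the clock runs, only of
    order [d], so every step near 0 costs [d] times the change of [H]. The number of steps grows
    without bound, hence these costs must telescope: a function [B] with increments dominating those
    of [H] is carried along as a compensator. Drift is computed by Tonelli from the law of one
    increment, without filtrations, which requires nonnegative functions: a constant is added, and a
    sign [sg] equal to 1 or -1 turns the resulting one-sided bound into a two-sided one. Finally the
    Taylor constants explode as [d] goes to 0, so the mesh must vanish at fixed [d] and limits are
    iterated, never joint; almost sure iterated limits are handled through upper limits, which also
    yield a measurable version of the local time at exit. *)

Section kernel.
Context {R : realFieldType}.
Implicit Types (a b d x y z : R).

Definition ramp x : R := Num.max x 0.
(** The second antiderivative of [ramp]. As [ramp] is 1-Lipschitz, the second order Taylor remainder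
    of [cramp] is at most [|y| ^+ 3 / 6]. *)
Definition cramp x : R := ramp x ^+ 3 / 6.

Lemma rampP x : (0 <= x /\ ramp x = x) \/ (x <= 0 /\ ramp x = 0).
Proof. by rewrite /ramp; have [h|h] := leP x 0; [right|left; rewrite ltW]. Qed.

Lemma cube_le a b : a <= b -> a ^+ 3 <= b ^+ 3.
Proof.
move=> ab; rewrite -subr_ge0.
rewrite (_ : b ^+ 3 - a ^+ 3 = (b - a) * ((b + a / 2) ^+ 2 + 3 / 4 * a ^+ 2)).
  by apply: mulr_ge0; [lra|rewrite addr_ge0 ?sqr_ge0// mulr_ge0 ?sqr_ge0//; lra].
by field.
Qed.

Lemma cube_le0 a : a <= 0 -> a ^+ 3 <= 0.
Proof. by move=> /cube_le; rewrite expr0n. Qed.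

Lemma cramp_taylor x y :
  `|cramp (x + y) - cramp x - ramp x ^+ 2 / 2 * y - ramp x / 2 * y ^+ 2|
    <= `|y| ^+ 3 / 6.
Proof.
rewrite /cramp -normrX ler_norml.
case: (rampP x) => -[x0 ->]; case: (rampP (x + y)) => -[xy0 ->].
- rewrite (_ : _ - _ = y ^+ 3 / 6); last by field.
  have := ler_norm (y ^+ 3); have := ler_norm (- (y ^+ 3)); rewrite normrN; lra.
- rewrite (_ : _ - _ = (y ^+ 3 - (x + y) ^+ 3) / 6); last by field.
  rewrite ler0_norm; last by apply: cube_le0; lra.
  have h1 : (x + y) ^+ 3 <= 0 by apply: cube_le0; lra.
  have h2 : y ^+ 3 <= (x + y) ^+ 3 by apply: cube_le; lra.
  lra.
- rewrite (_ : _ - _ = (x + y) ^+ 3 / 6); last by field.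
  have y0 : 0 <= y by lra.
  rewrite ger0_norm ?exprn_ge0//.
  have h1 : 0 <= (x + y) ^+ 3 by rewrite exprn_ge0.
  have h2 : (x + y) ^+ 3 <= y ^+ 3 by apply: cube_le; lra.
  lra.
- rewrite (_ : _ - _ = 0); last by field.
  by have h : 0 <= `|y ^+ 3| by []; lra.
Qed.

Lemma cramp_lip_le x y z : x <= y -> y <= z -> 0 <= z ->
  0 <= cramp y - cramp x <= (y - x) * z ^+ 2 / 2.
Proof.
move=> xy yz z0; rewrite /cramp.
have hr : ramp x <= ramp y.
  by case: (rampP x) => -[? ->]; case: (rampP y) => -[? ->]; lra.
have hr2 : ramp y - ramp x <= y - x.
  by case: (rampP x) => -[? ->]; case: (rampP y) => -[? ->]; lra.
have hx0 : 0 <= ramp x by case: (rampP x) => -[? ->].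
have hy : ramp y <= z by case: (rampP y) => -[? ->].
have h1 := cube_le hr.
apply/andP; split; first lra.
rewrite -subr_ge0.
set p := ramp x in hr hr2 hx0 hy *; set q := ramp y in hr hr2 hx0 hy *.
have e2 : (q - p) * (q^+2 + q * p + p ^+ 2) <= (y - x) * (3 * z ^+ 2).
  apply: ler_pM; [lra| |by []|].
    by rewrite !addr_ge0 ?sqr_ge0// mulr_ge0//; lra.
  have : q ^+ 2 <= z ^+ 2 by rewrite ler_sqr ?nnegrE//; lra.
  have : p ^+ 2 <= z ^+ 2 by rewrite ler_sqr ?nnegrE//; lra.
  have : q * p <= z * z by apply: ler_pM; lra.
  rewrite -expr2; lra.
have -> : (y - x) * z ^+ 2 / 2 - (q ^+ 3 / 6 - p ^+ 3 / 6) =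
   ((y - x) * (3 * z ^+ 2) - (q - p) * (q^+2 + q * p + p ^+ 2)) / 6 by field.
lra.
Qed.

(* The trapezoidal kernel of height [1 / (2 d)] on [-d', d'], d' = d - d ^+ 2,
   supported in [-d, d]. *)
Definition trap d x : R :=
  (ramp (x + d) - ramp (x + (d - d ^+ 2)) - ramp (x - (d - d ^+ 2))
   + ramp (x - d)) / (2 * d ^+ 3).

(** The second antiderivative of [trap d] that vanishes far to the left, hence a smoothing of
    [ramp]; [strap1 d] below is its derivative. *)
Definition strap d x : R :=
  (cramp (x + d) - cramp (x + (d - d ^+ 2)) - cramp (x - (d - d ^+ 2))
   + cramp (x - d)) / (2 * d ^+ 3).

Definition strap1 d x : R :=
  (ramp (x + d) ^+ 2 - ramp (x + (d - d ^+ 2)) ^+ 2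
   - ramp (x - (d - d ^+ 2)) ^+ 2
   + ramp (x - d) ^+ 2) / 2 / (2 * d ^+ 3).

(** Four copies of [cramp_taylor], each with error [1 / 6], divided by [2 * d ^+ 3]. *)
Lemma strap_taylor d x y : 0 < d ->
  `|strap d (x + y) - strap d x - strap1 d x * y - trap d x / 2 * y ^+ 2|
    <= `|y| ^+ 3 * (3 * d ^+ 3)^-1.
Proof.
move=> d0; have d30 : 0 < d ^+ 3 by rewrite exprn_gt0.
have d3n : d != 0 by lra.
have h1 := cramp_taylor (x + d) y.
have h2 := cramp_taylor (x + (d - d ^+ 2)) y.
have h3 := cramp_taylor (x - (d - d ^+ 2)) y.
have h4 := cramp_taylor (x - d) y.
rewrite /strap /strap1 /trap.
have E4 z : x + y + z = x + z + y by ring.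
rewrite !E4.
move: h1 h2 h3 h4.
set e1 := (X in `|X| <= _ -> _).
move=> h1; set e2 := (X in `|X| <= _ -> _).
move=> h2; set e3 := (X in `|X| <= _ -> _).
move=> h3; set e4 := (X in `|X| <= _ -> _) => h4.
set e := (X in `|X| <= _).
have -> : e = (e1 - e2 - e3 + e4) * (2 * d ^+ 3)^-1.
  rewrite /e /e1 /e2 /e3 /e4; field.
  by rewrite d3n.
rewrite normrM [X in _ * X <= _]ger0_norm; last by rewrite invr_ge0; lra.
have hh : `|e1 - e2 - e3 + e4| <= `|y| ^+ 3 * (2 / 3).
  have := ler_normD (e1 - e2 - e3) e4.
  have := ler_normB (e1 - e2) e3; have := ler_normB e1 e2; lra.
apply: (le_trans (ler_wpM2r _ hh)); first by rewrite invr_ge0; lra.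
rewrite le_eqVlt; apply/orP; left; apply/eqP; field.
by rewrite d3n.
Qed.

Lemma trap_ge0 d x : 0 < d -> d <= 1 -> 0 <= trap d x.
Proof.
move=> d0 d1; rewrite /trap divr_ge0//; last by rewrite mulr_ge0// exprn_ge0// ltW.
have d2 : 0 <= d ^+ 2 by exact: sqr_ge0.
have d22 : d ^+ 2 <= d by rewrite expr2; nra.
move: d2 d22; set e := d ^+ 2 => d2 d22.
case: (rampP (x + d)) => -[? ->]; case: (rampP (x + (d - e))) => -[? ->];
case: (rampP (x - (d - e))) => -[? ->]; case: (rampP (x - d)) => -[? ->]; lra.
Qed.

Lemma trap_le d x : 0 < d -> d <= 1 -> trap d x <= (2 * d)^-1.
Proof.
move=> d0 d1; rewrite /trap ler_pdivrMr; last by rewrite mulr_gt0// exprn_gt0.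
have -> : (2 * d)^-1 * (2 * d ^+ 3) = d ^+ 2 by field; lra.
have d2 : 0 <= d ^+ 2 by exact: sqr_ge0.
have d22 : d ^+ 2 <= d by rewrite expr2; nra.
move: d2 d22; set e := d ^+ 2 => d2 d22.
case: (rampP (x + d)) => -[? ->]; case: (rampP (x + (d - e))) => -[? ->];
case: (rampP (x - (d - e))) => -[? ->]; case: (rampP (x - d)) => -[? ->]; lra.
Qed.

Lemma trap_out d x : 0 < d -> d <= 1 -> d <= `|x| -> trap d x = 0.
Proof.
move=> d0 d1 dx; rewrite /trap.
have d2 : 0 <= d ^+ 2 by exact: sqr_ge0.
have d22 : d ^+ 2 <= d by rewrite expr2; nra.
move: d2 d22; set e := d ^+ 2 => d2 d22.
set s := (X in X / _); suff -> : s = 0 by rewrite mul0r.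
rewrite /s; move: dx; rewrite ler_normr => /orP[] dx;
case: (rampP (x + d)) => -[? ->]; case: (rampP (x + (d - e))) => -[? ->];
case: (rampP (x - (d - e))) => -[? ->]; case: (rampP (x - d)) => -[? ->]; lra.
Qed.

(** The slanted sides have width [d ^+ 2], positive so that the kernel is Lipschitz, yet negligible
    against [d]: the kernel is squeezed between two box kernels of widths equivalent to [d], whose
    time integrals define the local time. *)
Lemma trap_in d x : 0 < d -> d <= 1 -> `|x| <= d - d ^+ 2 -> trap d x = (2 * d)^-1.
Proof.
move=> d0 d1; rewrite ler_norml => /andP[dx dx'].
have -> : (2 * d)^-1 = d ^+ 2 / (2 * d ^+ 3) by field; lra.
rewrite /trap; congr (_ / _).
have d2 : 0 <= d ^+ 2 by exact: sqr_ge0.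
have d22 : d ^+ 2 <= d by rewrite expr2; nra.
move: d2 d22 dx dx'; set e := d ^+ 2 => d2 d22 dx dx'.
case: (rampP (x + d)) => -[? ->]; case: (rampP (x + (d - e))) => -[? ->];
case: (rampP (x - (d - e))) => -[? ->]; case: (rampP (x - d)) => -[? ->]; lra.
Qed.

(** To the right of the support the slope is the mass [1 - d / 2] of the trapezoid; there is no
    constant term because the kernel is centered. *)
Lemma strap_right d x : 0 < d -> d <= 1 -> d <= x -> strap d x = x * (1 - d / 2).
Proof.
move=> d0 d1 dx; rewrite /strap /cramp.
have d2 : 0 <= d ^+ 2 by exact: sqr_ge0.
have d22 : d ^+ 2 <= d by rewrite expr2; nra.
have r z : 0 <= z -> ramp z = z by rewrite /ramp; case: leP => //; lra.
by rewrite !r; [field|..]; lra.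
Qed.

Lemma strap_left d x : 0 < d -> d <= 1 -> x <= - d -> strap d x = 0.
Proof.
move=> d0 d1 dx; rewrite /strap /cramp.
have d2 : 0 <= d ^+ 2 by exact: sqr_ge0.
have d22 : d ^+ 2 <= d by rewrite expr2; nra.
have r z : z <= 0 -> ramp z = 0 by rewrite /ramp; case: leP => //; lra.
by rewrite !r; [rewrite expr0n /= !(mul0r, subr0, add0r)|..]; lra.
Qed.

(** The numerator is a difference of two increments of [cramp] over intervals of length [d ^+ 2].
    Both lie between 0 and [2 * d ^+ 4] by [cramp_lip_le], so their difference is at most this in
    absolute value. *)
Lemma strap_mid d x : 0 < d -> d <= 1 -> `|x| <= d -> `|strap d x| <= d.
Proof.
move=> d0 d1; rewrite ler_norml => /andP[dx dx'].
have d2 : 0 <= d ^+ 2 by exact: sqr_ge0.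
have d22 : d ^+ 2 <= d by rewrite expr2; nra.
have h1 := @cramp_lip_le (x + (d - d ^+ 2)) (x + d) (2 * d) ltac:(lra) ltac:(lra) ltac:(lra).
have h2 := @cramp_lip_le (x - d) (x - (d - d ^+ 2)) (2 * d) ltac:(lra) ltac:(lra) ltac:(lra).
rewrite /strap normrM [X in _ * X]ger0_norm; last first.
  by rewrite invr_ge0 mulr_ge0// exprn_ge0// ltW.
rewrite ler_pdivrMr; last by rewrite mulr_gt0// exprn_gt0.
rewrite ler_norml; move: h1 h2.
have -> : d * (2 * d ^+ 3) = (x + d - (x + (d - d ^+ 2))) * (2 * d) ^+ 2 / 2 by field.
have -> : (x - (d - d ^+ 2) - (x - d)) * (2 * d) ^+ 2 / 2 =
  (x + d - (x + (d - d ^+ 2))) * (2 * d) ^+ 2 / 2 by field.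
lra.
Qed.

Lemma strap_le d x : 0 < d -> d <= 1 -> `|strap d x| <= `|x| + d.
Proof.
move=> d0 d1; have [h|h] := leP `|x| d.
  by have := strap_mid d0 d1 h; have := normr_ge0 x; lra.
have [hx|hx] := leP 0 x.
  rewrite (ger0_norm hx) in h *.
  rewrite strap_right// ?ltW// ger0_norm; first nra.
  by apply: mulr_ge0 => //; lra.
rewrite (ltr0_norm hx) in h *.
by rewrite strap_left// ?normr0; lra.
Qed.


Lemma ramp_sqr_le x c : `|x| <= c -> ramp x ^+ 2 <= c ^+ 2.
Proof.
rewrite ler_norml => /andP[x1 x2]; have c0 : 0 <= c by lra.
rewrite ler_sqr ?nnegrE//; last by case: (rampP x) => -[x0 ->].
by case: (rampP x) => -[x0 ->].
Qed.

Lemma strap1_le d x c : 0 < d -> d <= 1 -> `|x| + 1 <= c ->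
  `|strap1 d x| <= c ^+ 2 / d ^+ 3.
Proof.
move=> d0 d1 xc; rewrite /strap1.
have d30 : 0 < d ^+ 3 by rewrite exprn_gt0.
have d2 : 0 <= d ^+ 2 by exact: sqr_ge0.
have d22 : d ^+ 2 <= d by rewrite expr2; nra.
move: d2 d22; set e := d ^+ 2 => d2 d22.
have hx1 := ler_norm x; have := ler_norm (- x); rewrite normrN => hx2.
have r z : `|z| <= c -> 0 <= ramp z ^+ 2 <= c ^+ 2.
  by move=> zc; rewrite sqr_ge0 ramp_sqr_le.
have /r h1 : `|x + d| <= c by rewrite ler_norml; lra.
have /r h2 : `|x + (d - e)| <= c by rewrite ler_norml; lra.
have /r h3 : `|x - (d - e)| <= c by rewrite ler_norml; lra.
have /r h4 : `|x - d| <= c by rewrite ler_norml; lra.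
move: h1 h2 h3 h4.
set r1 := ramp _ ^+ 2; set r2 := ramp _ ^+ 2; set r3 := ramp _ ^+ 2.
set r4 := ramp _ ^+ 2 => h1 h2 h3 h4.
have -> : (r1 - r2 - r3 + r4) / 2 / (2 * d ^+ 3) =
          ((r1 - r2 - r3 + r4) / 4) / d ^+ 3 by field; lra.
rewrite normrM [X in _ * X]ger0_norm; last by rewrite invr_ge0 ltW.
rewrite ler_pM2r ?invr_gt0// ler_norml; lra.
Qed.

End kernel.

Ltac nz := repeat match goal with |- is_true (andb _ _) => apply/andP; split end; lra.

(** * The smoothed and clamped profile *)

Section tent.
Context {R : realFieldType}.
Implicit Types (d x y z : R).
Variables (a b : R) (a0 : a < 0) (b0 : 0 < b).

Definition exit_mean : R := 2 * (- a) * b / (b - a).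

(** The jump at 0 of the derivative of the piecewise linear profile with value 0 at 0 and 1 at [a]
    and [b]. Half of it, [1 / exit_mean], is the rate at which the profile grows with the local
    time. *)
Definition exit_slope : R := b^-1 - a^-1.

Lemma exit_slopeE : exit_slope = 2 / exit_mean.
Proof. have ha := a0; have hb := b0; by rewrite /exit_slope /exit_mean; field; nz. Qed.

Lemma exit_mean_gt0 : 0 < exit_mean.
Proof. have ha := a0; have hb := b0; by rewrite /exit_mean; apply: divr_gt0; [apply: mulr_gt0|]; lra. Qed.

Lemma exit_slope_gt0 : 0 < exit_slope.
Proof. by rewrite exit_slopeE divr_gt0// exit_mean_gt0. Qed.

Definition tent d x : R := x / a + exit_slope * strap d x.

(** Dominates [tent d] on [[a - 1, b + 1]] for all [d <= 1]; the margin 1 lets every step of length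
    at most 1 from [[a, b]] avoid the clamp. *)
Definition tent_bound : R :=
  (b - a + 1) / (- a) + exit_slope * (b - a + 2).

Definition ctent d x : R :=
  Num.max (- tent_bound) (Num.min tent_bound (tent d x)).

Lemma tent_bound_ge1 : 1 <= tent_bound.
Proof.
have ha := a0; have hb := b0.
rewrite /tent_bound; have := exit_slope_gt0 => s0.
have h1 : 1 <= (b - a + 1) / (- a) by rewrite ler_pdivlMr; lra.
have h2 : 0 <= exit_slope * (b - a + 2) by rewrite mulr_ge0//; lra.
lra.
Qed.

(** Clamping to an interval brings a point no farther from any [c] of that interval. *)
Lemma ctent_dist d x c : `|c| <= tent_bound -> `|ctent d x - c| <= `|tent d x - c|.
Proof.
have ha := a0; have hb := b0.
rewrite /ctent ler_norml => /andP[c1 c2].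
have M1 := tent_bound_ge1.
set M := tent_bound in c1 c2 M1 *; set z := tent d x.
have h1 := ler_norm (z - c); have h2 := ler_norm (- (z - c)).
rewrite normrN in h2.
have [hz|hz] := leP M z.
  by have [h3|h3] := leP (- M) M; rewrite ler_norml; lra.
by have [h3|h3] := leP (- M) z; rewrite ler_norml; lra.
Qed.

Lemma ctent_id d x : `|tent d x| <= tent_bound -> ctent d x = tent d x.
Proof.
have ha := a0; have hb := b0.
move=> h; have := @ctent_dist d x _ h; rewrite subrr normr0 normr_le0.
by rewrite subr_eq0 => /eqP.
Qed.

Lemma ctent_le d x : `|ctent d x| <= tent_bound.
Proof.
have ha := a0; have hb := b0.
rewrite /ctent ler_norml; have M1 := tent_bound_ge1.
by rewrite le_max lexx/= ge_max ge_min lexx /= andbT; lra.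
Qed.

Lemma tent_le d x : 0 < d -> d <= 1 -> a - 1 <= x <= b + 1 ->
  `|tent d x| <= tent_bound.
Proof.
have ha := a0; have hb := b0.
move=> d0 d1 /andP[x1 x2]; rewrite /tent /tent_bound.
have s0 := exit_slope_gt0.
have hx : `|x| <= b - a + 1 by rewrite ler_norml; lra.
apply: (le_trans (ler_normD _ _)); apply: lerD.
  rewrite normrM normfV (ltr0_norm a0) ler_pM2r// invr_gt0; lra.
rewrite normrM (gtr0_norm s0) ler_pM2l//.
by have := strap_le x d0 d1; lra.
Qed.

Lemma ctent_small d x : 0 < d -> d <= 1 -> `|x| <= d ->
  `|ctent d x| <= ((- a)^-1 + exit_slope) * d.
Proof.
have ha := a0; have hb := b0.
move=> d0 d1 xd; have s0 := exit_slope_gt0.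
have := @ctent_dist d x 0; rewrite !subr0 normr0 => h.
apply: (le_trans (h _)); first by have := tent_bound_ge1; lra.
rewrite /tent; apply: (le_trans (ler_normD _ _)); rewrite [leRHS]mulrDl; apply: lerD.
  by rewrite normrM normfV (ltr0_norm a0) mulrC ler_pM2l// invr_gt0; lra.
by rewrite normrM (gtr0_norm s0) ler_pM2l// strap_mid.
Qed.

(** The terms of the constant are the overshoot margins at [b] and at [a], and the missing mass
    [d / 2] of the kernel, which lowers the profile near [b]. *)
Lemma ctent_exit d x : 0 < d -> d <= 1 -> d <= b / 2 -> d <= - a / 2 ->
  (b - d <= x <= b) \/ (a <= x <= a + d) ->
  `|ctent d x - 1| <= (b^-1 + (- a)^-1 + exit_slope * b) * d.
Proof.
have ha := a0; have hb := b0.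
move=> d0 d1 db da h; have s0 := exit_slope_gt0.
have ia : 0 < (- a)^-1 by rewrite invr_gt0; lra.
have ib : 0 < b^-1 by rewrite invr_gt0.
have sb : 0 < exit_slope * b by rewrite mulr_gt0.
have := @ctent_dist d x 1; rewrite normr1 => h1.
apply: (le_trans (h1 tent_bound_ge1)); rewrite /tent.
case: h => /andP[x1 x2].
  rewrite strap_right//; last by lra.
  have -> : x / a + exit_slope * (x * (1 - d / 2)) - 1
     = - (b^-1 * (b - x) + exit_slope * x * (d / 2)).
    by rewrite /exit_slope; field; nz.
  rewrite normrN ger0_norm; last first.
    apply: addr_ge0; first by apply: mulr_ge0; lra.
    by apply: mulr_ge0; [apply: mulr_ge0|]; lra.
  have e1 : b^-1 * (b - x) <= b^-1 * d by rewrite ler_pM2l//; lra.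
  have e2 : exit_slope * x * (d / 2) <= exit_slope * b * d.
    apply: ler_pM; [apply: mulr_ge0; lra|lra| |lra].
    by rewrite ler_pM2l.
  have e3 : 0 < (- a)^-1 * d by rewrite mulr_gt0.
  lra.
rewrite strap_left//; last by lra.
rewrite mulr0 addr0.
have -> : x / a - 1 = - ((- a)^-1 * (x - a)) by field; nz.
rewrite normrN ger0_norm; last by apply: mulr_ge0; lra.
have e1 : (- a)^-1 * (x - a) <= (- a)^-1 * d by rewrite ler_pM2l//; lra.
have e2 : 0 < (b^-1 + exit_slope * b) * d by rewrite mulr_gt0//; lra.
lra.
Qed.

(** For [|y| <= 1] the clamp is inactive and this is [strap_taylor]. For [|y| > 1] all terms are
    dominated by [|y| ^+ 3]. The slope [c1] may stay unspecified, since centered increments cancel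
    the linear term. *)
Lemma ctent_taylor d : 0 < d -> d <= 1 -> exists2 K, 0 <= K &
  forall x, a <= x <= b -> exists c1, forall y,
   `|ctent d (x + y) - (ctent d x + c1 * y + trap d x / exit_mean * y ^+ 2)|
    <= K * `|y| ^+ 3.
Proof.
have ha := a0; have hb := b0.
move=> d0 d1; have s0 := exit_slope_gt0; have m0 := exit_mean_gt0.
have d30 : 0 < d ^+ 3 by rewrite exprn_gt0.
pose K0 := exit_slope / (3 * d ^+ 3).
pose K1 := (- a)^-1 + exit_slope * ((b - a + 1) ^+ 2 / d ^+ 3).
pose K2 := (2 * d)^-1 / exit_mean.
have K00 : 0 <= K0 by rewrite /K0 divr_ge0// ltW// mulr_gt0.
have K20 : 0 <= K2 by rewrite /K2 divr_ge0// ltW// invr_gt0 mulr_gt0.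
have K10 : 0 <= K1.
  rewrite /K1 addr_ge0 ?invr_ge0 ?oppr_ge0 1?ltW// mulr_gt0// divr_gt0//.
  by rewrite exprn_gt0//; lra.
(* For long steps the same sum bounds both the increment of the profile and, up to [K0], the
   quadratic polynomial subtracted from it. *)
exists (2 * (K1 + K2 + K0)); first by apply: mulr_ge0; [|apply: addr_ge0; [apply: addr_ge0|]].
move=> x /andP[x1 x2].
exists (a^-1 + exit_slope * strap1 d x) => y.
set c1 := a^-1 + _.
have T y' : `|tent d (x + y') - (tent d x + c1 * y' + trap d x / exit_mean * y' ^+ 2)|
    <= K0 * `|y'| ^+ 3.
  have h := strap_taylor x y' d0.
  have -> : tent d (x + y') - (tent d x + c1 * y' + trap d x / exit_mean * y' ^+ 2)
    = exit_slope * (strap d (x + y') - strap d x - strap1 d x * y' - trap d x / 2 * y' ^+ 2).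
    by rewrite /tent /c1 exit_slopeE; field; nz.
  have -> : K0 * `|y'| ^+ 3 = exit_slope * (`|y'| ^+ 3 * (3 * d ^+ 3)^-1).
    by rewrite /K0; ring.
  by rewrite normrM (gtr0_norm s0) ler_pM2l.
have hx : `|tent d x| <= tent_bound by apply: tent_le => //; lra.
have cx := ctent_id hx.
rewrite cx.
have y3 : 0 <= `|y| ^+ 3 by rewrite exprn_ge0.
have [hy|hy] := leP `|y| 1.
  move: (hy); rewrite ler_norml => /andP[y1 y2].
  rewrite ctent_id; last by apply: tent_le => //; lra.
  apply: (le_trans (T y)); rewrite ler_wpM2r//; lra.
have c1K : `|c1| <= K1.
  rewrite /c1 /K1; apply: (le_trans (ler_normD _ _)); apply: lerD.
    by rewrite normfV (ltr0_norm a0).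
  rewrite normrM (gtr0_norm s0) ler_pM2l//; apply: strap1_le => //.
  have : `|x| <= b - a by rewrite ler_norml; lra.
  lra.
have tK : `|trap d x / exit_mean| <= K2.
  rewrite ger0_norm; last by rewrite divr_ge0 ?trap_ge0// ltW.
  by rewrite /K2 ler_pM2r ?invr_gt0// trap_le.
have L : `|tent d (x + y) - tent d x| <= (K1 + K2 + K0) * `|y| ^+ 3.
  have -> : tent d (x + y) - tent d x = (tent d (x + y) -
     (tent d x + c1 * y + trap d x / exit_mean * y ^+ 2))
     + c1 * y + trap d x / exit_mean * y ^+ 2 by ring.
  have e1 : `|c1 * y| <= K1 * `|y| ^+ 3.
    rewrite normrM; apply: ler_pM => //.
    by rewrite -[X in X <= _]expr1; apply: ler_weXn2l => //; exact: ltW.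
  have e2 : `|trap d x / exit_mean * y ^+ 2| <= K2 * `|y| ^+ 3.
    rewrite normrM normrX; apply: ler_pM; rewrite ?exprn_ge0//.
    by apply: ler_weXn2l => //; exact: ltW.
  apply: (le_trans (ler_normD _ _)).
  have := ler_normD (tent d (x + y) -
     (tent d x + c1 * y + trap d x / exit_mean * y ^+ 2)) (c1 * y).
  have := T y; lra.
have := @ctent_dist d (x + y) _ hx.
have := T y.
have := ler_normD (ctent d (x + y) - tent d x) (- (c1 * y + trap d x / exit_mean * y ^+ 2)).
have -> : ctent d (x + y) - tent d x - (c1 * y + trap d x / exit_mean * y ^+ 2) =
  ctent d (x + y) - (tent d x + c1 * y + trap d x / exit_mean * y ^+ 2) by ring.
rewrite normrN => e1 e2 e3.
have e4 : `|c1 * y + trap d x / exit_mean * y ^+ 2| <= (K1 + K2) * `|y| ^+ 3.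
  apply: (le_trans (ler_normD _ _)); rewrite [leRHS]mulrDl; apply: lerD.
    rewrite normrM; apply: ler_pM => //.
    by rewrite -[X in X <= _]expr1; apply: ler_weXn2l => //; exact: ltW.
  rewrite normrM normrX; apply: ler_pM; rewrite ?exprn_ge0//.
  by apply: ler_weXn2l => //; exact: ltW.
have e5 : 0 <= K0 * `|y| ^+ 3 by rewrite mulr_ge0.
lra.
Qed.

End tent.

(** * Markov chains driven by independent increments *)

Section product_unique.
Context d1 d2 (T1 : measurableType d1) (T2 : measurableType d2) (R : realType).

Lemma measure_prod_unique (m1 m2 : {measure set (T1 * T2) -> \bar R}) :
  (m1 setT < +oo)%E ->
  (forall A B, measurable A -> measurable B -> m1 (A `*` B) = m2 (A `*` B)) ->
  forall E, measurable E -> m1 E = m2 E.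
Proof.
move=> m1oo m12 E mE.
pose C : set (set (T1 * T2)) :=
  [set C | exists A, measurable A /\ exists B, measurable B /\ C = A `*` B].
apply: (measure_unique C (fun=> setT)) => //.
- rewrite measurable_prod_measurableType //; congr (<<s _ >>).
  rewrite predeqE => U; split => [[A mA [B mB <-]]|[A [mA [B [mB ->]]]]].
    by exists A; split => //; exists B.
  by exists A => //; exists B.
- move=> _ _ [X1 [mX1 [X2 [mX2 ->]]]] [Y1 [mY1 [Y2 [mY2 ->]]]].
  rewrite -setXI; exists (X1 `&` Y1); split; first exact: measurableI.
  by exists (X2 `&` Y2); split => //; exact: measurableI.
- by move=> _; exists setT; split => //; exists setT; split => //; rewrite setXTT.
- by rewrite bigcup_const.
- by move=> _ [A [mA [B [mB ->]]]]; exact: m12.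
Qed.

End product_unique.

Section freezing.
Context d (T : measurableType d) (R : realType) (P : probability T R).
Context d1 (S : measurableType d1) d2 (V : measurableType d2).
Variables (U : T -> S) (X : T -> V) (nu : probability V R).
Hypotheses (mU : measurable_fun setT U) (mX : measurable_fun setT X).
Hypothesis UX : forall C B, measurable C -> measurable B ->
  P (U @^-1` C `&` X @^-1` B) = (P (U @^-1` C) * nu B)%E.

(** [UX] says that the law of [(U, X)] is a product of the law of [U] and [nu], so Tonelli applies.
    This takes the place of conditioning on [U]. *)
Lemma expectation_freezing (g : S * V -> \bar R) :
  measurable_fun setT g -> (forall z, 0 <= g z)%E ->
  (\int[P]_t g (U t, X t) = \int[P]_t \int[nu]_x g (U t, x))%E.
Proof.
move=> mg g0.
have mUX : measurable_fun setT (fun t => (U t, X t)).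
  exact: measurable_fun_pair.
pose U' : {mfun T >-> S} := HB.pack U (isMeasurableFun.Build _ _ _ _ _ mU).
pose UX' : {mfun T >-> (S * V)%type} :=
  HB.pack (fun t => (U t, X t)) (isMeasurableFun.Build _ _ _ _ _ mUX).
rewrite -(@ge0_integral_distribution _ _ _ _ _ P UX')//.
transitivity (\int[(distribution P U' \x nu)%E]_z g z)%E.
  apply: eq_measure_integral => E' mE' _.
  by apply/esym; apply: product_measure_unique.
rewrite fubini_tonelli1//.
rewrite ge0_integral_distribution//.
  exact: measurable_fun_fubini_tonelli_F.
by move=> s; apply: integral_ge0.
Qed.

End freezing.

Section chain.
Context d (T : measurableType d) (R : realType) (P : probability T R).
Context d' (S : measurableType d').
Variables (X : nat -> T -> R) (step : S * R -> S) (u0 : S).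
Hypotheses (mX : forall i, measurable_fun setT (X i)).
Hypotheses (mstep : measurable_fun setT step).

Fixpoint chain k t : S :=
  if k is k'.+1 then step (chain k' t, X k' t) else u0.

Lemma measurable_chain k : measurable_fun setT (chain k).
Proof.
elim: k => [|k IH] /=; first exact: measurable_cst.
apply: (measurableT_comp mstep).
exact: measurable_fun_pair.
Qed.

Variable N : nat.
Hypothesis indX : mutually_independent P (fun i : 'I_N => X i).

(** With [F] fixed, both sides are finite measures in [E]; the hypothesis identifies them on
    rectangles, which suffices by [measure_prod_unique]. *)
Lemma independent_restrict (E : set (S * R)) k (F : set T) :
  measurable E -> measurable F ->
  (forall C B, measurable C -> measurable B ->
    P ((chain k @^-1` C `&` X k @^-1` B) `&` F) =
    (P (chain k @^-1` C `&` X k @^-1` B) * P F)%E) ->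
  P ((fun t => (chain k t, X k t)) @^-1` E `&` F) =
  (P ((fun t => (chain k t, X k t)) @^-1` E) * P F)%E.
Proof.
move=> mE mF H; set UX := fun t => (chain k t, X k t).
have mUX : measurable_fun setT UX.
  by apply: measurable_fun_pair => //; exact: measurable_chain.
pose UX' : {mfun T >-> (S * R)%type} :=
  HB.pack UX (isMeasurableFun.Build _ _ _ _ _ mUX).
have PF : (fine (P F))%:E = P F by rewrite fineK// fin_num_measure.
have F0 : 0 <= fine (P F) by rewrite fine_ge0.
have @m1 : {measure set (S * R) -> \bar R}.
  by refine (pushforward (mrestr P mF) UX').
have @m2 : {measure set (S * R) -> \bar R}.
  by refine (mscale (NngNum F0) (distribution P UX')).
transitivity (m1 E); first by [].
rewrite (@measure_prod_unique _ _ _ _ _ m1 m2)//.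
- by rewrite /m2 /= /mscale /= PF muleC.
- rewrite /m1 /= /pushforward /mrestr /=.
  by rewrite ltey_eq fin_num_measure//; rewrite preimage_setT setTI.
- move=> A B mA mB; rewrite /m1 /m2 /= /mscale /= PF muleC.
  exact: H.
Qed.

Lemma measurable_cylinder (B : nat -> set R) : (forall i, measurable (B i)) ->
  measurable (\bigcap_(i : 'I_N) (X i @^-1` B i)).
Proof.
move=> mB; apply: fin_bigcap_measurable; first exact: finite_finset.
by move=> i _; rewrite -[X in measurable X]setTI; exact: mX.
Qed.

Lemma cylinder_split (B : nat -> set R) k : (k < N)%N ->
  (forall i, measurable (B i)) -> B k = setT ->
  forall D, measurable D ->
  \bigcap_(i : 'I_N) (X i @^-1` (if i == k :> nat then D else B i)) =
    X k @^-1` D `&` \bigcap_(i : 'I_N) (X i @^-1` B i) /\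
  P (\bigcap_(i : 'I_N) (X i @^-1` (if i == k :> nat then D else B i))) =
  (P (X k @^-1` D) * P (\bigcap_(i : 'I_N) (X i @^-1` B i)))%E.
Proof.
move=> kN mB Bk D mD; split.
  apply/seteqP; split => t.
    move=> H; split; first by have := H (Ordinal kN) I; rewrite /= eqxx.
    move=> i _; have := H i I; case: eqP => [ik _|//] /=.
    by rewrite ik Bk.
  by move=> [tD H] i _; case: eqP => [->//|_]; exact: H.
rewrite (indX (B := fun i : 'I_N => if i == k :> nat then D else B i)); last first.
  by move=> i; case: eqP.
rewrite (indX (B := fun i : 'I_N => B i))//.
rewrite (bigD1 (Ordinal kN))//= eqxx; congr (_ * _)%E.
rewrite [RHS](bigD1 (Ordinal kN))//= Bk preimage_setT probability_setT mul1e.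
apply: eq_bigr => i ik; rewrite ifF//; apply/negbTE; apply: contra ik => /eqP ik.
by apply/eqP/val_inj.
Qed.

(** The state at time [k] is independent of all increments from [k] on, jointly: independence from
    [X k] alone would not survive the induction. In the step, [X k] is moved between the past and
    the future by putting its constraint [B'] at index [k] of the cylinder. *)
Lemma chain_indep k : (k <= N)%N -> forall C (B : nat -> set R), measurable C ->
  (forall i, measurable (B i)) -> (forall i, (i < k)%N -> B i = setT) ->
  P (chain k @^-1` C `&` \bigcap_(i : 'I_N) (X i @^-1` B i)) =
  (P (chain k @^-1` C) * P (\bigcap_(i : 'I_N) (X i @^-1` B i)))%E.
Proof.
elim: k => [_ C B mC mB _|k IH kN C B mC mB Bk].
  have [Cu|Cu] := pselect (C u0).
    rewrite (_ : _ @^-1` C = setT) ?setTI ?probability_setT ?mul1e//.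
    by apply/seteqP; split.
  rewrite (_ : _ @^-1` C = set0) ?set0I ?measure0 ?mul0e//.
  by apply/seteqP; split.
have mF := measurable_cylinder mB.
apply: (independent_restrict (E := step @^-1` C)) => //.
  by rewrite -[X in measurable X]setTI; exact: mstep.
move=> C' B' mC' mB'.
have [e1 e2] := cylinder_split kN mB (Bk k (ltnSn k)) mB'.
have mB1 i : measurable (if i == k then B' else B i) by case: eqP.
rewrite -setIA -e1 (IH (ltnW kN) C' (fun i => if i == k then B' else B i))//; last first.
  move=> i ik; rewrite ifF; first by apply: Bk; exact: ltnW.
  by apply/negbTE; rewrite ltn_eqF.
rewrite e2 muleA; congr (_ * _)%E.
have [e3 e4] := cylinder_split kN (B := fun=> setT) (fun=> measurableT) erefl mB'.
have bT : \bigcap_(i : 'I_N) (X i @^-1` setT) = setT.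
  by apply/seteqP; split.
rewrite bT setIT in e3; rewrite -e3.
rewrite (IH (ltnW kN) C' (fun i => if i == k then B' else setT))//.
- by move=> i; case: eqP.
- move=> i ik; rewrite ifF//; apply/negbTE; rewrite ltn_eqF//.
Qed.

Variable nu : probability (measurableTypeR R) R.
Hypothesis lawX : forall k, (k < N)%N -> forall B, measurable B ->
  P (X k @^-1` B) = nu B.

Lemma chain_indep_next k : (k < N)%N -> forall C B, measurable C -> measurable B ->
  P (chain k @^-1` C `&` X k @^-1` B) = (P (chain k @^-1` C) * nu B)%E.
Proof.
move=> kN C B mC mB.
have [e3 e4] := cylinder_split kN (B := fun=> setT) (fun=> measurableT) erefl mB.
have bT : \bigcap_(i : 'I_N) (X i @^-1` setT) = setT.
  by apply/seteqP; split.
rewrite bT setIT in e3; rewrite -(lawX kN mB) -e3.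
rewrite (chain_indep (ltnW kN) (B := fun i => if i == k then B else setT))//.
- by move=> i; case: eqP.
- move=> i ik; rewrite ifF//; apply/negbTE; rewrite ltn_eqF//.
Qed.

(** An approximate supermartingale inequality: the error [e] of one step accumulates linearly. [D]
    is an invariant set of states on which the one-step bound is known. *)
Lemma chain_drift (D : set S) (g : S -> R) (e : R) :
  measurable_fun setT g -> (forall s, 0 <= g s) -> 0 <= e ->
  D u0 -> (forall s x, D s -> D (step (s, x))) ->
  (forall s, D s -> (\int[nu]_x (g (step (s, x)))%:E <= (g s + e)%:E)%E) ->
  forall k, (k <= N)%N ->
    (\int[P]_t (g (chain k t))%:E <= (g u0 + k%:R * e)%:E)%E.
Proof.
move=> mg g0 e0 Du0 Dstep Hg; elim => [_|k IH kN].
  by rewrite /= integral_cst//= probability_setT mule1 mul0r addr0.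
have DC j t : D (chain j t) by elim: j => //= j; exact: Dstep.
have mk := measurable_chain k.
have mgs : measurable_fun setT (fun z : S * R => (g (step z))%:E).
  by apply/measurable_EFinP; apply: (measurableT_comp mg).
rewrite /=.
rewrite (@expectation_freezing _ T R P _ S _ (measurableTypeR R) (chain k) (X k) nu mk (mX k) (chain_indep_next kN) (fun z => (g (step z))%:E))//; last first.
  by move=> z; rewrite lee_fin.
apply: (@le_trans _ _ (\int[P]_t ((g (chain k t))%:E + e%:E))%E).
  apply: ge0_le_integral => //.
  - by move=> t _; apply: integral_ge0 => x _; rewrite lee_fin.
  - have h := @measurable_fun_fubini_tonelli_F _ _ S (measurableTypeR R) R nu
      (fun z => (g (step z))%:E) mgs.
    apply: (measurableT_comp (f := fun s => (\int[nu]_x (g (step (s, x)))%:E)%E)) => //.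
    by apply: h => z; rewrite lee_fin.
  - apply: emeasurable_funD => //; apply/measurable_EFinP.
    by apply: measurableT_comp.
  - by move=> t _; rewrite -EFinD; apply: Hg; exact: DC.
rewrite ge0_integralD//.
- rewrite integral_cst//= probability_setT mule1.
  rewrite -[in leRHS]natr1 mulrDl mul1r addrA EFinD leeD2r//.
  by apply: IH; exact: ltnW.
- by move=> t _; rewrite lee_fin.
- by apply/measurable_EFinP; apply: measurableT_comp.
Qed.

End chain.

(** * Gaussian moments *)

Section integral_real_line.
Context {R : realType}.
Notation mu := (@lebesgue_measure R).

Lemma integral_FTC_limit (f F : R -> R) (l : R) :
  continuous f -> mu.-integrable setT (EFin \o f) ->
  (forall x : R, is_derive x 1 F (f x)) ->
  F n%:R - F (- n%:R) @[n --> \oo] --> l ->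
  (\int[mu]_x (f x)%:E = l%:E)%E.
Proof.
move=> cf intf dF Fl.
(* The half-width [n.+1] keeps the interval nondegenerate, as [continuous_FTC2] requires. *)
pose D n : set R := `[- n.+1%:R, n.+1%:R]%classic.
have mf : measurable_fun setT (EFin \o f) := measurable_int _ intf.
have := @dominated_convergence _ _ _ mu setT measurableT
  (fun n => (EFin \o f) \_ (D n)) (EFin \o f) (abse \o (EFin \o f)).
case.
- move=> n; apply/(measurable_restrict _ _ _).1 => //.
    exact: measurable_itv.
  exact: measurable_funS mf.
- by [].
- apply: aeW => x _; apply: cvg_near_cst.
  exists (Num.truncn `|x|) => // n /= hn; rewrite patchE ifT//.
  rewrite inE /D /= in_itv /=; rewrite -ler_norml.
  apply: ltW; apply: (lt_le_trans (truncnS_gt _)).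
  by rewrite ler_nat.
- exact: integrable_abse.
- apply: aeW => x n _ /=; rewrite patchE; case: ifPn => // _.
  by rewrite abse0.
move=> _ _ cvgi; apply: (cvg_unique _ cvgi) => //=.
have -> : (fun n => \int[mu]_x ((EFin \o f) \_ (D n)) x)%E =
          (fun n => (F n.+1%:R - F (- n.+1%:R))%:E).
  apply/funext => n; rewrite -integral_mkcond.
  rewrite (continuous_FTC2 (F := F))//.
  - by have : (0 : R) < n.+1%:R by []; lra.
  - exact: continuous_subspaceT.
  - split.
    + by move=> x _; have [] := dF x.
    + apply: cvg_at_right_filter; apply: differentiable_continuous.
      by apply/derivable1_diffP; have [] := dF (- n.+1%:R).
    + apply: cvg_at_left_filter; apply: differentiable_continuous.
      by apply/derivable1_diffP; have [] := dF n.+1%:R.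
  - by move=> x _; rewrite derive1E; have [_ ->] := dF x.
apply: cvg_EFin; first by near=> n.
by rewrite -(cvg_shiftS (fun n => F n%:R - F (- n%:R))) in Fl.
Unshelve. all: end_near.
Qed.

End integral_real_line.

Section gaussian_moments.
Context {R : realType}.
Notation mu := (@lebesgue_measure R).
Variables (s : R) (s0 : 0 < s).

Lemma integral_normal_prob (f : R -> \bar R) : measurable_fun setT f ->
  (\int[normal_prob 0 s]_x `|f x| < +oo)%E ->
  (\int[normal_prob 0 s]_x f x = \int[mu]_x (f x * (normal_pdf 0 s x)%:E))%E.
Proof.
move=> mf finf.
rewrite -(Radon_Nikodym_change_of_variables (normal_prob_dominates 0 s))//=; last first.
  by apply/integrableP; split.
apply: ae_eq_integral => //.
- apply: emeasurable_funM => //; apply: (measurable_int mu).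
  by apply: Radon_Nikodym_integrable; exact: normal_prob_dominates.
- apply: emeasurable_funM => //=; apply/measurableT_comp => //=.
  exact: measurable_normal_pdf.
- apply: ae_eqe_mul2l => /=.
  rewrite Radon_NikodymE//=; first exact: normal_prob_dominates.
  move=> abmu.
  case: cid => /= h [h1 h2 h3].
  apply: integral_ae_eq => //=.
  + by apply/measurableT_comp => //; exact: measurable_normal_pdf.
  + by move=> E E01 mE; rewrite -h3.
Qed.

Let p := normal_pdf 0 s.

Let sn0 : s != 0. Proof. exact: lt0r_neq0. Qed.

Lemma is_derive_normal_pdf (x : R) : is_derive x 1 p (- (x / s ^+ 2) * p x).
Proof.
rewrite /p normal_pdfE// /normal_fun.
apply: is_derive_eq.
rewrite /GRing.scale /= !subr0.
field.
exact: sn0.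
Qed.

Lemma continuous_normal_p : continuous p.
Proof. exact: continuous_normal_pdf. Qed.

(** Domination by a Gaussian density of doubled deviation yields at once the integrability of the
    moments up to order 4 and the decay of the boundary terms in the integrations by parts. *)
Lemma normal_pdf_moment4 : exists2 C, 0 <= C &
  forall x, x ^+ 4 * p x <= C * normal_pdf 0 (2 * s) x.
Proof.
have s2n0 : 2 * s != 0 by rewrite mulf_neq0.
have pk := normal_peak_gt0 s2n0.
exists (2 * (8 * s ^+ 2 / 3) ^+ 2 * normal_peak s / normal_peak (2 * s)).
  apply: divr_ge0; last exact: normal_peak_ge0.
  apply: mulr_ge0; last exact: normal_peak_ge0.
  by apply: mulr_ge0 => //; exact: sqr_ge0.
move=> x; rewrite /p !normal_pdfE// /normal_fun !subr0.
(* [expR (- y)] is, up to the normalizing peaks, the ratio of the two densities, and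
   [y ^+ 2 / 2 <= expR y]. *)
pose y := 3 * x ^+ 2 / (8 * s ^+ 2).
have y0 : 0 <= y by rewrite /y divr_ge0// mulr_ge0// sqr_ge0.
have -> : - x ^+ 2 / ((2 * s) ^+ 2 *+ 2) = y + - x ^+ 2 / (s ^+ 2 *+ 2).
  by rewrite /y; field.
rewrite expRD; set E := expR (- x ^+ 2 / (s ^+ 2 *+ 2)).
have := expR_ge1Dxn 1 y0; rewrite /= (_ : 2`!%:R = 2 :> R)// => hy.
have -> : x ^+ 4 = (8 * s ^+ 2 / 3) ^+ 2 * y ^+ 2 by rewrite /y; field.
have -> : 2 * (8 * s ^+ 2 / 3) ^+ 2 * normal_peak s / normal_peak (2 * s) *
  (normal_peak (2 * s) * (expR y * E)) =
  ((8 * s ^+ 2 / 3) ^+ 2 * (2 * expR y)) * (normal_peak s * E).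
  by field; exact: lt0r_neq0.
apply: ler_wpM2r; first by rewrite mulr_ge0 ?normal_peak_ge0 ?expR_ge0.
apply: ler_wpM2l; first exact: sqr_ge0.
lra.
Qed.

Lemma integrable_normal_moment k : (k <= 4)%N ->
  mu.-integrable setT (EFin \o (fun x => x ^+ k * p x)).
Proof.
move=> k4; have [C C0 HC] := normal_pdf_moment4.
have i1 : mu.-integrable setT (fun x => (C%:E * (normal_pdf 0 (2 * s) x)%:E + (p x)%:E)%E).
  apply: integrableD => //; last exact: integrable_normal_pdf.
  by apply: integrableZl => //; exact: integrable_normal_pdf.
apply: le_integrable i1 => //.
  apply/measurable_EFinP; apply: measurable_funM; first exact: measurable_funX.
  exact: measurable_normal_pdf.
move=> x _ /=.
have p0 : 0 <= p x by exact: normal_pdf_ge0.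
have q0 : 0 <= normal_pdf 0 (2 * s) x by exact: normal_pdf_ge0.
rewrite lee_fin (@ger0_norm _ (_ + _)); last by rewrite addr_ge0// mulr_ge0.
rewrite normrM (ger0_norm p0) normrX.
apply: (@le_trans _ _ ((x ^+ 4 + 1) * p x)); last first.
  by rewrite mulrDl mul1r lerD2r.
apply: ler_wpM2r => //.
have -> : x ^+ 4 = `|x| ^+ 4.
  by rewrite -normrX ger0_norm// exprn_even_ge0.
have [x1|x1] := leP `|x| 1.
  by apply: (@le_trans _ _ 1); [exact: exprn_ile1|rewrite lerDr exprn_ge0].
apply: (@le_trans _ _ (`|x| ^+ 4)); last by rewrite lerDl.
by apply: ler_weXn2l => //; exact: ltW.
Qed.

Lemma cvg_normal_moment (k : nat) : (k <= 3)%N ->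
  n%:R ^+ k * p n%:R @[n --> \oo] --> 0.
Proof.
move=> k3; have [C C0 HC] := normal_pdf_moment4.
have s2n0 : 2 * s != 0 by rewrite mulf_neq0.
rewrite -cvg_shiftS /=.
apply: (@squeeze_cvgr _ _ _ _ (fun=> 0) (fun n => C * normal_peak (2 * s) * n.+1%:R^-1)).
- apply: nearW => n; have p0 : 0 <= p n.+1%:R by exact: normal_pdf_ge0.
  rewrite mulr_ge0//=; rewrite ler_pdivlMr//.
  apply: (@le_trans _ _ (n.+1%:R ^+ 4 * p n.+1%:R)).
    rewrite -mulrA [p _ * _]mulrC mulrA ler_wpM2r// -exprSr.
    by apply: ler_weXn2l => //; rewrite ler1n.
  apply: (le_trans (HC _)); apply: ler_wpM2l => //; exact: normal_pdf_ub.
- exact: cvg_cst.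
- rewrite -[X in _ --> X](mulr0 (C * normal_peak (2 * s))).
  apply: cvgM; first exact: cvg_cst.
  exact: cvg_harmonic.
Qed.

Lemma normal_pdf_sym x : p (- x) = p x.
Proof. by rewrite /p normal_pdfE// /normal_fun !subr0 sqrrN. Qed.

Let derive_mom (k : nat) (x : R) :
  is_derive x 1 (fun x => - (s ^+ 2) * (x ^+ k * p x))
   (x ^+ k.+1 * p x - s ^+ 2 * (k%:R * x ^+ k.-1 * p x)).
Proof.
have dp := is_derive_normal_pdf x.
have h := is_deriveZ (- (s ^+ 2)) (is_deriveM (is_deriveX k (is_derive_id x (1 : R))) dp).
have -> : (fun x => - (s ^+ 2) * (x ^+ k * p x)) = - (s ^+ 2) \*: (id ^+ k * p).
  by apply/funext => y; rewrite !fctE.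
apply: (is_derive_eq h).
rewrite /GRing.scale /= (_ : (id ^+ k) x = x ^+ k); last by rewrite !fctE.
case: k {h} => [|k] /=.
  by rewrite !expr0 expr1; field; exact: sn0.
by rewrite (exprS x k.+1) (exprS x k); field; exact: sn0.
Qed.

Let cont_mom (k : nat) : continuous (fun x : R => x ^+ k * p x).
Proof.
move=> x; apply: cvgM; first exact: exprn_continuous.
exact: continuous_normal_p.
Qed.

(** Integration by parts, with [- s ^+ 2 * (x ^+ k * p x)] as the antiderivative of the difference.
    At [k = 0] the truncated [k.-1] is harmless, its coefficient being 0. *)
Lemma integral_normal_recurrence (k : nat) : (k <= 3)%N ->
  (\int[mu]_x (x ^+ k.+1 * p x)%:E =
   (s ^+ 2 * k%:R)%:E * \int[mu]_x (x ^+ k.-1 * p x)%:E)%E.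
Proof.
move=> k3.
have i1 := @integrable_normal_moment k.+1 k3.
have i2 := @integrable_normal_moment k.-1 (leq_trans (leq_pred k) (leqW k3)).
have i3 : mu.-integrable setT (EFin \o (fun x => s ^+ 2 * k%:R * (x ^+ k.-1 * p x))).
  have := integrableZl measurableT (s ^+ 2 * k%:R) i2.
  by apply: eq_integrable => // x _; rewrite /= EFinM.
pose f x := x ^+ k.+1 * p x - s ^+ 2 * k%:R * (x ^+ k.-1 * p x).
have : (\int[mu]_x (f x)%:E = 0%:E)%E.
  apply: (@integral_FTC_limit _ _ (fun x => - (s ^+ 2) * (x ^+ k * p x))).
  - move=> x; apply: cvgB; first exact: cont_mom.
    by apply: cvgM; [exact: cvg_cst|exact: cont_mom].
  - have := integrableB measurableT i1 i3.
    by apply: eq_integrable => // x _; rewrite /= EFinB.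
  - move=> x; have := derive_mom k x; congr is_derive.
    by rewrite /f; ring.
  - rewrite (_ : (fun n => _) = fun n : nat => - (s ^+ 2 * (1 - (-1) ^+ k)) * (n%:R ^+ k * p n%:R)).
      rewrite -[X in _ --> X](mulr0 (- (s ^+ 2 * (1 - (-1) ^+ k)))).
      by apply: cvgM; [exact: cvg_cst|exact: cvg_normal_moment].
    apply/funext => n; rewrite normal_pdf_sym -[in (- n%:R) ^+ k]mulN1r exprMn; ring.
under eq_integral do rewrite /f EFinB.
rewrite integralB_EFin//.
under [X in (_ - X)%E = _]eq_integral do rewrite EFinM.
rewrite integralZl// => /eqP.
rewrite sube_eq ?add0e; first by move/eqP ->.
- exact: integrable_fin_num.
- rewrite fin_num_adde_defr//.
Qed.

Let M (k : nat) : R := \int[mu]_x (x ^+ k * p x).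

Let M0 : M 0 = 1.
Proof.
rewrite /M /Rintegral.
under eq_integral do rewrite expr0 mul1r.
by rewrite integral_normal_pdf.
Qed.

Let MS k : (k <= 3)%N -> M k.+1 = s ^+ 2 * k%:R * M k.-1.
Proof.
move=> k3; rewrite /M /Rintegral integral_normal_recurrence// fineM//.
apply: integrable_fin_num => //; apply: integrable_normal_moment.
exact: leq_trans (leq_pred k) (leqW k3).
Qed.

Lemma normal_expectation_le (f : R -> R) (c0 c1 c2 K B : R) :
  measurable_fun setT f -> (forall x, 0 <= f x <= B) -> 0 <= K ->
  (forall x, f x <= c0 + c1 * x + c2 * x ^+ 2 + K * `|x| ^+ 3) ->
  (\int[normal_prob 0 s]_x (f x)%:E <= (c0 + c2 * s ^+ 2 + 2 * K * s ^+ 3)%:E)%E.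
Proof.
move=> mf fB K0 fq.
have mfE : measurable_fun setT (EFin \o f) by exact/measurable_EFinP.
rewrite integral_normal_prob//; last first.
  apply: (@le_lt_trans _ _ (\int[normal_prob 0 s]_x B%:E)%E).
    apply: ge0_le_integral => //.
    - exact: measurableT_comp.
    - move=> x _ /=; rewrite lee_fin ger0_norm; by have /andP[] := fB x.
  by rewrite integral_cst//= probability_setT mule1 ltry.
pose d2 := c2 + K * s / 2; pose d4 := K / (2 * s).
pose m k x := x ^+ k * p x.
have im k : (k <= 4)%N -> mu.-integrable setT (EFin \o m k).
  exact: integrable_normal_moment.
have ic c k : (k <= 4)%N -> mu.-integrable setT (EFin \o (fun x => c * m k x)).
  move=> /im h; have := integrableZl measurableT c h.
  by apply: eq_integrable => // x _; rewrite /= EFinM.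
have iD g h : mu.-integrable setT (EFin \o g) -> mu.-integrable setT (EFin \o h) ->
    mu.-integrable setT (EFin \o (fun x => g x + h x)).
  move=> ig ih; have := integrableD measurableT ig ih.
  by apply: eq_integrable => // x _; rewrite /= EFinD.
have ip : mu.-integrable setT (EFin \o p) by exact: integrable_normal_pdf.
have ic0 : mu.-integrable setT (EFin \o (fun x => c0 * p x)).
  have := integrableZl measurableT c0 ip.
  by apply: eq_integrable => // x _; rewrite /= EFinM.
have p1 : \int[mu]_x p x = 1 by rewrite /Rintegral integral_normal_pdf.
pose q x := c0 * p x + c1 * m 1 x + d2 * m 2 x + d4 * m 4 x.
have iq : mu.-integrable setT (EFin \o q).
  by do ! apply: (iD) => //; exact: ic.
have Eq : \int[mu]_x q x = c0 + c2 * s ^+ 2 + 2 * K * s ^+ 3.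
  rewrite /q RintegralD//; [|by do ! apply: (iD) => //; exact: ic|exact: ic].
  rewrite RintegralD//; [|by do ! apply: (iD) => //; exact: ic|exact: ic].
  rewrite RintegralD//; [|exact: ic].
  rewrite !RintegralZl//; try exact: im.
  rewrite p1 -/(M 1) -/(M 2) -/(M 4) !MS//= M0 /d2 /d4.
  by field; exact: sn0.
apply: (@le_trans _ _ (\int[mu]_x (q x)%:E)%E); last first.
  by rewrite -Eq fineK// integrable_fin_num.
apply: ge0_le_integral => //.
- move=> x _; rewrite mule_ge0// lee_fin; last exact: normal_pdf_ge0.
  by have /andP[] := fB x.
- apply: emeasurable_funM => //; apply/measurable_EFinP.
  exact: measurable_normal_pdf.
- exact: measurable_int iq.
- move=> x _; rewrite -EFinM lee_fin.
  have -> : q x = (c0 + c1 * x + d2 * x ^+ 2 + d4 * x ^+ 4) * p x.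
    by rewrite /q /m; ring.
  apply: ler_wpM2r; first exact: normal_pdf_ge0.
  apply: (le_trans (fq x)); rewrite -subr_ge0.
  have -> : c0 + c1 * x + d2 * x ^+ 2 + d4 * x ^+ 4 -
    (c0 + c1 * x + c2 * x ^+ 2 + K * `|x| ^+ 3) =
    K / (2 * s) * (`|x| * (s - `|x|)) ^+ 2.
    rewrite /d2 /d4 (_ : x ^+ 4 = (x ^+ 2) ^+ 2); last by ring.
    by rewrite -(real_normK (num_real x)); field; exact: sn0.
  by rewrite mulr_ge0 ?sqr_ge0// divr_ge0// mulr_ge0// ltW.
Qed.

End gaussian_moments.

(** * The discrete Ito formula *)

Section bounded_integrals.
Context d (T : measurableType d) (R : realType) (P : probability T R).

Lemma integrable_bounded (f : T -> R) (M : R) : measurable_fun setT f ->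
  (forall t, `|f t| <= M) -> P.-integrable setT (EFin \o f).
Proof.
move=> mf fM; apply: (@le_integrable _ _ _ P setT measurableT _ (EFin \o cst M)).
- exact/measurable_EFinP.
- by move=> t _ /=; rewrite lee_fin (le_trans (fM t))// ler_norm.
- exact: finite_measure_integrable_cst.
Qed.

Lemma Rintegral_prob_cst (c : R) : \int[P]_t c = c.
Proof. by rewrite Rintegral_cst//= probability_setT /= mulr1. Qed.

Lemma normr_Rintegral_le (f : T -> R) (M : R) : measurable_fun setT f ->
  (forall t, `|f t| <= M) -> `|\int[P]_t f t| <= M.
Proof.
move=> mf fM; have i1 := integrable_bounded mf fM.
apply: (le_trans (le_normr_Rintegral measurableT i1)).
rewrite -[leRHS](Rintegral_prob_cst M); apply: le_Rintegral => //.
- apply: (@integrable_bounded _ M); first exact: measurableT_comp.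
  by move=> t; rewrite normr_id.
- exact: finite_measure_integrable_cst.
Qed.

End bounded_integrals.

(* Test functions for Stein's equation of the exponential law: [H] is the
   derivative of [K], and [B] dominates the variation of [H]. *)
Record stein_test (R : realType) (H K B : R -> R) (C : R) : Prop := {
  stein_measurable : [/\ measurable_fun setT H, measurable_fun setT K &
                         measurable_fun setT B];
  stein_bounded : forall l, [/\ `|H l| <= C, `|K l| <= C & `|B l| <= C];
  stein_deriv : forall x y, 0 <= x -> x <= y ->
    `|K y - K x - H y * (y - x)| <= C * (y - x) ^+ 2;
  stein_variation : forall x y, 0 <= x -> x <= y -> `|H y - H x| <= B y - B x
}.

Section discrete_ito.
Context {R : realType}.
Variables (a b : R) (a0 : a < 0) (b0 : 0 < b).
Local Notation m := (exit_mean a b).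

(** A state is a position with a clock, the Riemann sum of the kernel along the walk. The clock
    advances according to the position before the step, so its new value does not depend on the
    increment [z.2]. *)
Definition walk_step (d h : R) (z : (R * R) * R) : R * R :=
  if (a + d < z.1.1) && (z.1.1 < b - d)
  then (z.1.1 + z.2, z.1.2 + h * trap d z.1.1) else z.1.

Definition stein_fun (H K : R -> R) (d : R) (u : R * R) : R :=
  ctent a b d u.1 * H u.2 - K u.2 / m.

Lemma measurable_ramp : measurable_fun setT (@ramp R).
Proof. exact: measurable_maxr. Qed.

Lemma measurable_trap d : measurable_fun setT (@trap R d).
Proof.
apply: measurable_funM => //.
apply: measurable_funD; [apply: measurable_funB; [apply: measurable_funB|]|];
  apply: (measurableT_comp measurable_ramp); [exact: measurable_funD|
  exact: measurable_funD|exact: measurable_funB|exact: measurable_funB].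
Qed.

Lemma measurable_cramp : measurable_fun setT (@cramp R).
Proof.
apply: measurable_funM => //; apply: measurable_funX; exact: measurable_ramp.
Qed.

Lemma measurable_ctent d : measurable_fun setT (ctent a b d).
Proof.
apply: measurable_maxr => //; apply: measurable_minr => //.
apply: measurable_funD; first exact: measurable_funM.
apply: measurable_funM => //; apply: measurable_funM => //.
apply: measurable_funD; [apply: measurable_funB; [apply: measurable_funB|]|];
  apply: (measurableT_comp measurable_cramp); [exact: measurable_funD|
  exact: measurable_funD|exact: measurable_funB|exact: measurable_funB].
Qed.

Lemma measurable_walk_step d h : measurable_fun setT (walk_step d h).
Proof.
have m11 : measurable_fun setT (fun z : (R * R) * R => z.1.1).
  by apply: (measurableT_comp (f := fst)) => //; exact: measurable_fst.
have m12 : measurable_fun setT (fun z : (R * R) * R => z.1.2).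
  by apply: (measurableT_comp (f := snd)) => //; exact: measurable_snd.
apply: measurable_fun_ifT.
- by apply: measurable_and; apply: measurable_fun_ltr.
- apply: measurable_fun_pair.
    by apply: measurable_funD => //; exact: measurable_snd.
  apply: measurable_funD => //; apply: measurable_funM => //.
  exact: (measurableT_comp (measurable_trap d)).
- exact: measurable_fst.
Qed.

Lemma measurable_stein_fun H K d : measurable_fun setT H -> measurable_fun setT K ->
  measurable_fun setT (stein_fun H K d).
Proof.
move=> mH mK; apply: measurable_funB; apply: measurable_funM => //.
- by apply: (measurableT_comp (measurable_ctent d)); exact: measurable_fst.
- by apply: (measurableT_comp mH); exact: measurable_snd.
- by apply: (measurableT_comp mK); exact: measurable_snd.
Qed.

Lemma stein_fun_le H K B C d u : stein_test H K B C ->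
  `|stein_fun H K d u| <= tent_bound a b * C + C / m.
Proof.
move=> st; have [hH hK _] := stein_bounded st u.2.
apply: (le_trans (ler_normB _ _)); apply: lerD; rewrite normrM.
  by apply: ler_pM => //; exact: ctent_le.
rewrite [X in _ * X]gtr0_norm ?invr_gt0 ?exit_mean_gt0//.
by rewrite ler_wpM2r// invr_ge0 ltW// exit_mean_gt0.
Qed.

Definition ctent_slope : R := (- a)^-1 + exit_slope a b.

Lemma ctent_slope_gt0 : 0 < ctent_slope.
Proof. by rewrite addr_gt0 ?invr_gt0 ?oppr_gt0 ?exit_slope_gt0. Qed.

Definition comp_bound (d C : R) : R :=
  tent_bound a b * C + C / m + ctent_slope * d * C.

(** The term in [B] absorbs the changes of [H] near 0, where [ctent] is at most [ctent_slope * d];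
    the constant [comp_bound] makes the function nonnegative. *)
Definition comp_fun (sg d C : R) (H K B : R -> R) (v : R * R) : R :=
  sg * stein_fun H K d v - ctent_slope * d * B v.2 + comp_bound d C.

Lemma comp_fun_bounds sg d C H K B v : stein_test H K B C -> 0 < d ->
  (sg = 1 \/ sg = -1) -> 0 <= comp_fun sg d C H K B v <= 2 * comp_bound d C.
Proof.
move=> st d0 sg1; have [_ _ hB] := stein_bounded st v.2.
have c0 : 0 <= ctent_slope * d by rewrite mulr_ge0// ltW// ctent_slope_gt0.
have hF := stein_fun_le d v st.
have sgn1 : `|sg| = 1 by case: sg1 => ->; rewrite ?normrN normr1.
have e1 : `|sg * stein_fun H K d v| <= tent_bound a b * C + C / m.
  by rewrite normrM sgn1 mul1r.
have e2 : `|ctent_slope * d * B v.2| <= ctent_slope * d * C.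
  by rewrite normrM (ger0_norm c0) ler_wpM2l.
move: e1 e2; rewrite !ler_norml /comp_fun /comp_bound => /andP[? ?] /andP[? ?].
by apply/andP; split; lra.
Qed.

Lemma measurable_comp_fun sg d C H K B : stein_test H K B C ->
  measurable_fun setT (comp_fun sg d C H K B).
Proof.
move=> /stein_measurable[mH mK mB].
apply: measurable_funD => //; apply: measurable_funB; apply: measurable_funM => //.
  exact: measurable_stein_fun.
by apply: (measurableT_comp mB); exact: measurable_snd.
Qed.

(** The discrete Ito computation. The position is expanded with the clock already at its new value
    [l']; its second order term, of mean [H l' * (h * trap d s) / m], cancels the change of [K / m].
    This is why [stein_deriv] expands [K] at the right endpoint. *)
Lemma walk_step_drift H K B C d : stein_test H K B C -> 0 <= C ->
  0 < d -> d <= 1 -> exists2 E, 0 <= E &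
  forall sg h u, (sg = 1 \/ sg = -1) -> 0 < h -> 0 <= u.2 ->
  (\int[normal_prob 0 (Num.sqrt h)]_x
     (comp_fun sg d C H K B (walk_step d h (u, x)))%:E <=
   (comp_fun sg d C H K B u + E * (Num.sqrt h ^+ 3 + h ^+ 2))%:E)%E.
Proof.
move=> st C0 d0 d1.
have [K3 K30 HT] := ctent_taylor a0 b0 d0 d1.
have m0 := exit_mean_gt0 a0 b0.
have Q0 : 0 <= (2 * d)^-1 ^+ 2 / m.
  by rewrite divr_ge0 ?sqr_ge0// ltW.
exists (C * ((2 * d)^-1 ^+ 2 / m + 2 * K3)).
  by rewrite mulr_ge0// addr_ge0// mulr_ge0.
move=> sg h [s l] sg1 h0 l0; rewrite /= in l0.
have c0 : 0 <= ctent_slope * d by rewrite mulr_ge0// ltW// ctent_slope_gt0.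
have sh0 : 0 < Num.sqrt h by rewrite sqrtr_gt0.
have sg_le x : sg * x <= `|x|.
  by case: sg1 => ->; rewrite ?mul1r ?mulN1r ?ler_norm// -normrN ler_norm.
have sgn1 : `|sg| = 1 by case: sg1 => ->; rewrite ?normrN normr1.
have e0 : 0 <= Num.sqrt h ^+ 3 + h ^+ 2.
  by rewrite addr_ge0 ?sqr_ge0// exprn_ge0// ltW.
have mg := measurable_comp_fun sg d st.
rewrite /walk_step /=.
case: (boolP ((a + d < s) && (s < b - d))) => [/andP[s1 s2]|_]; last first.
  rewrite integral_cst//= probability_setT mule1 lee_fin lerDl.
  by rewrite !mulr_ge0// addr_ge0// mulr_ge0.
set l' := l + h * trap d s.
have V0 : 0 <= trap d s by exact: trap_ge0.
have V1 : trap d s <= (2 * d)^-1 by exact: trap_le.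
have ll' : l <= l' by rewrite lerDl mulr_ge0// ltW.
have [c1 Hc1] : exists c1, forall y,
   `|ctent a b d (s + y) - (ctent a b d s + c1 * y + trap d s / m * y ^+ 2)|
    <= K3 * `|y| ^+ 3.
  by apply: HT; apply/andP; split; lra.
have [hH hK _] := stein_bounded st l'.
pose k0 := sg * (ctent a b d s * H l' - K l' / m) - ctent_slope * d * B l' + comp_bound d C.
apply: (le_trans (@normal_expectation_le _ _ sh0
  (fun x => comp_fun sg d C H K B (s + x, l')) k0 (sg * H l' * c1)
  (sg * H l' * (trap d s / m)) (C * K3) (2 * comp_bound d C) _ _ _ _)).
- apply: (measurableT_comp mg); apply: measurable_fun_pair => //.
  exact: measurable_funD.
- by move=> x; exact: comp_fun_bounds.
- exact: mulr_ge0.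
- move=> x; rewrite /comp_fun /stein_fun /k0 /=.
  rewrite -subr_ge0.
  have e := Hc1 x.
  set r := ctent a b d (s + x) - _ in e.
  have -> : ctent a b d (s + x) = r + (ctent a b d s + c1 * x + trap d s / m * x ^+ 2).
    by rewrite /r; ring.
  have e1 : sg * (H l' * r) <= C * (K3 * `|x| ^+ 3).
    apply: (le_trans (sg_le _)); rewrite normrM; exact: ler_pM.
  set q := (X in 0 <= X).
  have -> : q = C * (K3 * `|x| ^+ 3) - sg * (H l' * r) by rewrite /q; ring.
  by rewrite subr_ge0.
rewrite lee_fin /comp_fun /stein_fun /=.
rewrite sqr_sqrtr; last exact: ltW.
have D1 := stein_deriv st l0 ll'.
have D2 := stein_variation st l0 ll'.
have l'l : l' - l = h * trap d s by rewrite /l'; ring.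
rewrite l'l in D1.
(* Either the position is in the support of the kernel and the profile is small, or the clock stands
   still and [H] does not change. *)
have D3 : sg * (ctent a b d s * (H l' - H l)) <= ctent_slope * d * (B l' - B l).
  have [sd|sd] := leP `|s| d.
    apply: (le_trans (sg_le _)); rewrite normrM; apply: ler_pM => //.
    exact: ctent_small.
  have V00 : trap d s = 0 by apply: trap_out => //; exact: ltW.
  have -> : l' = l by rewrite /l' V00; ring.
  by rewrite !subrr !mulr0.
have D4 : - sg * ((K l' - K l - H l' * (h * trap d s)) / m) <=
  C * ((2 * d)^-1 ^+ 2 / m) * h ^+ 2.
  rewrite mulNr -mulrN; apply: (le_trans (sg_le _)); rewrite normrN normrM.
  rewrite [X in _ * X]gtr0_norm ?invr_gt0//.
  rewrite [leRHS](_ : _ = C * ((2 * d)^-1 * h) ^+ 2 / m); last by ring.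
  rewrite ler_pM2r ?invr_gt0//; apply: (le_trans D1).
  apply: ler_wpM2l => //; rewrite mulrC ler_sqr ?nnegrE.
  - by apply: ler_wpM2r => //; exact: ltW.
  - by rewrite mulr_ge0// ltW.
  - by rewrite mulr_ge0 ?invr_ge0 ?mulr_ge0// ltW.
rewrite /k0 -subr_ge0.
have e5 : 0 <= C * ((2 * d)^-1 ^+ 2 / m) * Num.sqrt h ^+ 3.
  by apply: mulr_ge0; [exact: mulr_ge0|rewrite exprn_ge0// ltW].
have e6 : 0 <= C * (2 * K3) * h ^+ 2 by apply: mulr_ge0; [apply: mulr_ge0 => //; exact: mulr_ge0|exact: sqr_ge0].
lra.
Qed.

Section walk.
Context dd (T : measurableType dd) (P : probability T R).
Variables (X : nat -> T -> R) (N : nat) (h : R) (h0 : 0 < h).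
Hypothesis mX : forall i, measurable_fun setT (X i).
Hypothesis indX : mutually_independent P (fun i : 'I_N => X i).
Hypothesis lawX : forall k, (k < N)%N -> forall B, measurable B ->
  P (X k @^-1` B) = normal_prob 0 (Num.sqrt h) B.

Definition walk (d : R) : nat -> T -> R * R := chain X (walk_step d h) (0, 0).

Lemma measurable_walk d k : measurable_fun setT (walk d k).
Proof. by apply: measurable_chain => //; exact: measurable_walk_step. Qed.

Lemma walk_ge0 d k t : 0 < d -> d <= 1 -> 0 <= (walk d k t).2.
Proof.
move=> d0 d1; rewrite /walk; elim: k => //= k IH.
rewrite {1}/walk_step; case: ifP => //= _.
by rewrite addr_ge0// mulr_ge0 ?trap_ge0// ltW.
Qed.

End walk.

(** The compensator telescopes to a difference of two values of [B], at most [2 * C], whatever the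
    number of steps. [E] depends on [d] but on neither [N] nor [h], so the last term vanishes with
    the mesh when [N%:R * h] is fixed. *)
Lemma discrete_stein (H K B : R -> R) (C d : R) : stein_test H K B C -> 0 <= C ->
  0 < d -> d <= 1 -> exists2 E, 0 <= E &
  forall dd (T : measurableType dd) (P : probability T R) (X : nat -> T -> R) (N : nat) (h : R), 0 < h ->
  (forall i, measurable_fun setT (X i)) ->
  mutually_independent P (fun i : 'I_N => X i) ->
  (forall k, (k < N)%N -> forall B, measurable B ->
     P (X k @^-1` B) = normal_prob 0 (Num.sqrt h) B) ->
  `|\int[P]_t stein_fun H K d (walk X h d N t) - stein_fun H K d (0, 0)|
   <= 2 * (ctent_slope * d) * C + N%:R * (E * (Num.sqrt h ^+ 3 + h ^+ 2)).
Proof.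
move=> st C0 d0 d1; have [E E0 HE] := walk_step_drift st C0 d0 d1.
exists E => // dd T P X N h h0 mX indX lawX.
have mw := measurable_walk h mX d N.
have [mH mK mB] := stein_measurable st.
have mF : measurable_fun setT (fun t => stein_fun H K d (walk X h d N t)).
  by apply: (measurableT_comp (f := stein_fun H K d)) => //; exact: measurable_stein_fun.
have mBw : measurable_fun setT (fun t => B (walk X h d N t).2).
  exact: (measurableT_comp mB (measurableT_comp measurable_snd mw)).
have hF t := stein_fun_le d (walk X h d N t) st.
have hB t : `|B (walk X h d N t).2| <= C by have [] := stein_bounded st (walk X h d N t).2.
have iF := integrable_bounded P mF hF.
have iB := integrable_bounded P mBw hB.
have bB := normr_Rintegral_le P mBw hB.
have bB0 : `|B 0| <= C by have [] := stein_bounded st 0.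
have c0 : 0 <= ctent_slope * d by rewrite mulr_ge0// ltW// ctent_slope_gt0.
have key sg : (sg = 1 \/ sg = -1) ->
  sg * (\int[P]_t stein_fun H K d (walk X h d N t) - stein_fun H K d (0, 0))
   <= 2 * (ctent_slope * d) * C + N%:R * (E * (Num.sqrt h ^+ 3 + h ^+ 2)).
  move=> sg1.
  have e0 : 0 <= E * (Num.sqrt h ^+ 3 + h ^+ 2).
    by rewrite mulr_ge0// addr_ge0 ?sqr_ge0// exprn_ge0// sqrtr_ge0.
  have := @chain_drift _ T R P _ (R * R)%type X (walk_step d h) (0, 0) mX
    (measurable_walk_step d h) N indX (normal_prob 0 (Num.sqrt h)) lawX
    [set u | 0 <= u.2] (comp_fun sg d C H K B) (E * (Num.sqrt h ^+ 3 + h ^+ 2))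
    (measurable_comp_fun sg d st).
  have gb v := comp_fun_bounds v st d0 sg1.
  move=> /(_ (fun v => proj1 (andP (gb v))) e0 (lexx 0)).
  have inv u x : [set u | 0 <= u.2] u -> [set u | 0 <= u.2] (walk_step d h (u, x)).
    rewrite /walk_step /= => u2; case: ifP => //= _.
    by rewrite addr_ge0// mulr_ge0 ?trap_ge0// ltW.
  move=> /(_ inv (fun u u2 => HE sg h u sg1 h0 u2) N (leqnn N)).
  rewrite -/(walk X h d).
  have ig : P.-integrable setT (EFin \o (fun t => comp_fun sg d C H K B (walk X h d N t))).
    apply: (@integrable_bounded _ _ _ _ _ (2 * comp_bound d C)).
      by apply: (measurableT_comp (f := comp_fun sg d C H K B)) => //; exact: measurable_comp_fun.
    by move=> t; have /andP[g0 g2] := gb (walk X h d N t); rewrite ger0_norm.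
  rewrite -[X in (X <= _)%E -> _]fineK ?integrable_fin_num// lee_fin.
  rewrite -/(Rintegral _ _ _) /comp_fun.
  have is1 : P.-integrable setT (EFin \o (fun t => sg * stein_fun H K d (walk X h d N t))).
    have := integrableZl measurableT sg iF.
    by apply: eq_integrable => // x _; rewrite /= EFinM.
  have is2 : P.-integrable setT (EFin \o (fun t => ctent_slope * d * B (walk X h d N t).2)).
    have := integrableZl measurableT (ctent_slope * d) iB.
    by apply: eq_integrable => // x _; rewrite /= EFinM.
  have is3 : P.-integrable setT (EFin \o (fun t => sg * stein_fun H K d (walk X h d N t) - ctent_slope * d * B (walk X h d N t).2)).
    have := integrableB measurableT is1 is2.
    by apply: eq_integrable => // x _; rewrite /= EFinB.
  rewrite RintegralD//; last exact: finite_measure_integrable_cst.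
  rewrite RintegralB// !RintegralZl// Rintegral_prob_cst /=.
  move: bB bB0; rewrite !ler_norml => /andP[b1 b2] /andP[b3 b4].
  set I1 := \int[P]_t stein_fun H K d _; set I2 := \int[P]_t B _ in b1 b2 *.
  move=> h1.
  have h2 : ctent_slope * d * (I2 - B 0) <= ctent_slope * d * (2 * C).
    by rewrite ler_wpM2l//; lra.
  lra.
rewrite ler_norml; apply/andP; split; last first.
  by have := key 1 (or_introl erefl); rewrite mul1r.
by have := key (-1) (or_intror erefl); rewrite mulN1r; lra.
Qed.

End discrete_ito.

(** * Riemann sums and exit times of continuous paths *)

Section real_paths.
Context {R : realType}.
Notation mu := (@lebesgue_measure R).
Implicit Types (g v : R -> R).

Lemma continuous_dist g (x e : R) : continuous g -> 0 < e ->
  exists2 r : R, 0 < r & forall y, `|x - y| < r -> `|g x - g y| < e.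
Proof.
move=> cg e0; have /cvgrPdist_lt /(_ e e0) := cg x.
move=> /nbhs_ballP[r /= r0 hr]; exists r => // y xy; exact: hr.
Qed.

(** Paths are only constrained at nonnegative times; freezing them before 0 gives functions
    continuous on the whole line. *)
Lemma continuous_extension g : {within `[0, +oo[, continuous g} ->
  continuous (fun t : R => g (Num.max t 0)).
Proof.
move=> /continuous_within_itvcyP[cg cg0] x.
apply/cvgrPdist_lt => e e0; apply/nbhs_ballP.
have [x0|x0|->] := ltgtP x 0.
- exists (- x); first by rewrite /= oppr_gt0.
  move=> y /=; rewrite /ball/= => xy.
  have y0 : y < 0 by move: xy; rewrite ltr_norml; lra.
  by rewrite !max_r ?ltW// subrr normr0.
- have xi : x \in `]0, +oo[ by rewrite in_itv /= x0.
  have /cvgrPdist_lt /(_ e e0) /nbhs_ballP[r /= r0 hr] := cg x xi.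
  exists (Num.min r x); first by rewrite /= lt_min r0.
  move=> y /=; rewrite /ball/= lt_min => /andP[xr yx].
  have y0 : 0 < y by move: yx; rewrite ltr_norml; lra.
  rewrite !max_l ?ltW//; exact: hr.
- have /cvgrPdist_lt /(_ e e0) := cg0.
  rewrite near_withinE => /nbhs_ballP[r /= r0 hr].
  exists r => // y /=; rewrite /ball/= => yr.
  have [y0|y0] := ltP 0 y.
    by rewrite ?max_l ?ltW//; apply: hr.
  by rewrite ?max_r ?subrr ?normr0.
Qed.

Lemma uniformly_continuous_segment v (M e : R) : continuous v -> 0 < e ->
  exists2 k : R, 0 < k & forall x y, 0 <= x <= M -> `|x - y| <= k ->
    `|v x - v y| <= e.
Proof.
move=> cv e0.
have H : \forall k \near (0^'+ : set_system R), `[0, M] `<=`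
    (fun x => forall y, `|x - y| <= k -> `|v x - v y| <= e).
  apply: (compact_near_coveringP (`[0, M]%classic)).1.
    exact: segment_compact.
  move=> x _; have [r r0 hr] := @continuous_dist v x (e / 2) cv (divr_gt0 e0 (ltr0Sn _ _)).
  exists (ball x (r / 2), [set k | k < r / 2]) => /=.
    split; first by apply: nbhsx_ballx; rewrite divr_gt0.
    by apply: nbhs_right_lt; rewrite divr_gt0.
  move=> [x' k] /= [xx' kr] y x'y.
  move: xx'; rewrite /ball /= => xx'.
  have h1 : `|v x - v x'| < e / 2 by apply: hr; lra.
  have h2 : `|v x - v y| < e / 2.
    by apply: hr; apply: (le_lt_trans (ler_distD x' _ _)); lra.
  apply: (le_trans (ler_distD (v x) _ _)); rewrite (distrC (v x')); lra.
have [k [k0 Hk]] : exists k : R, 0 < k /\ `[0, M] `<=`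
      (fun x => forall y, `|x - y| <= k -> `|v x - v y| <= e).
  apply: (@filter_ex _ (0^'+ : set_system R)).
  by near=> k; split; near: k; [exact: nbhs_right_gt|exact: H].
by exists k => // x y xM; apply: Hk; rewrite /= in_itv.
Unshelve. all: end_near.
Qed.

Lemma integrable_continuous_itv v (x y : R) : continuous v ->
  mu.-integrable `[x, y] (EFin \o v).
Proof.
move=> cv; apply: continuous_compact_integrable; first exact: segment_compact.
exact: continuous_subspaceT.
Qed.

Lemma riemann_sum_dist v (M e h : R) : continuous v -> 0 < h ->
  (forall x y, 0 <= x <= M -> `|x - y| <= h -> `|v x - v y| <= e) ->
  forall k : nat, k%:R * h <= M ->
  `|\sum_(j < k) h * v (j%:R * h) - \int[mu]_(x in `[0, k%:R * h]) v x| <= k%:R * h * e.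
Proof.
move=> cv h0 hv; elim => [_|k IH kM].
  rewrite big_ord0 mul0r mul0r set_itv1 Rintegral_set1 subrr normr0//.
have kh : k%:R * h <= k.+1%:R * h by rewrite ler_pM2r// ler_nat.
have kh0 : 0 <= k%:R * h by rewrite mulr_ge0// ltW.
have sk : k.+1%:R * h = k%:R * h + h by rewrite -natr1 mulrDl mul1r.
have IH' := IH (le_trans kh kM).
rewrite big_ord_recr /=.
have := @Rintegral_itvB R v (BLeft 0) (BRight (k.+1%:R * h)) (k%:R * h).
move=> /(_ (integrable_continuous_itv _ _ cv)); rewrite !bnd_simp => /(_ kh0 kh) Esplit.
have -> : \int[mu]_(x in `[0, k.+1%:R * h]) v x =
  \int[mu]_(x in `[0, k%:R * h]) v x + \int[mu]_(x in `]k%:R * h, k.+1%:R * h]) v x.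
  by rewrite -Esplit; ring.
set I1 := \int[mu]_(x in `[0, k%:R * h]) v x in IH' *.
set I2 := \int[mu]_(x in `]_, _]) v x.
set S := \sum_(i < k) _ in IH' *.
have i2 : mu.-integrable `]k%:R * h, k.+1%:R * h] (EFin \o v).
  apply: integrableS (integrable_continuous_itv (k%:R * h) (k.+1%:R * h) cv) => //.
  by apply: subset_itvr; rewrite bnd_simp.
have mlen : mu `]k%:R * h, k.+1%:R * h]%classic = h%:E.
  rewrite lebesgue_measure_itv /= lte_fin ifT ?sk ?ltrDl//.
  by rewrite -EFinD; congr (_%:E); ring.
have ic c : mu.-integrable `]k%:R * h, k.+1%:R * h] (EFin \o cst c).
  apply: integrableS (integrable_continuous_itv (k%:R * h) (k.+1%:R * h) (@cst_continuous _ _ c)) => //.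
  by apply: subset_itvr; rewrite bnd_simp.
have E2 : `|h * v (k%:R * h) - I2| <= h * e.
  have -> : h * v (k%:R * h) = \int[mu]_(x in `]k%:R * h, k.+1%:R * h]) v (k%:R * h).
    by rewrite Rintegral_cst//= mlen /= mulrC.
  rewrite -RintegralB//; last exact: (ic (v (k%:R * h))).
  apply: (le_trans (le_normr_Rintegral _ _)) => //.
    have := integrableB (measurable_itv `]k%:R * h, k.+1%:R * h] : measurable (_ : set (measurableTypeR R))) (ic (v (k%:R * h))) i2.
    by apply: eq_integrable => // x _; rewrite /= EFinB.
  have -> : h * e = \int[mu]_(x in `]k%:R * h, k.+1%:R * h]) e.
    by rewrite Rintegral_cst//= mlen /= mulrC.
  apply: le_Rintegral => //.
  - have := integrable_abse (integrableB (measurable_itv `]k%:R * h, k.+1%:R * h] : measurable (_ : set (measurableTypeR R))) (ic (v (k%:R * h))) i2).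
    by apply: eq_integrable => // x _; rewrite /= EFinB.
  - exact: ic.
  - move=> x /=; rewrite in_itv /= => /andP[x1 x2]; apply: hv.
      by rewrite kh0 (le_trans kh kM).
    by rewrite ler_norml; apply/andP; split; lra.
rewrite (_ : _ - _ = (S - I1) + (h * v (k%:R * h) - I2)); last by ring.
apply: (le_trans (ler_normD _ _)).
rewrite sk mulrDl; exact: lerD.
Qed.

End real_paths.

Section exit_paths.
Context {R : realType}.
Notation mu := (@lebesgue_measure R).
Variables (a b : R) (a0 : a < 0) (b0 : 0 < b).
Variable g : R -> R.
Hypotheses (cg : continuous g) (g00 : g 0 = 0).

Definition is_first_exit (tau : R) : Prop :=
  [/\ 0 < tau, g tau = a \/ g tau = b & forall t, 0 <= t -> t < tau -> a < g t < b].

Lemma first_exitP : (exists t, 0 <= t /\ (g t = a \/ g t = b)) ->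
  exists2 tau, is_first_exit tau &
    ereal_inf [set t%:E | t in [set t | 0 <= t /\ (g t = a \/ g t = b)]] = tau%:E.
Proof.
have ha := a0; have hb := b0.
set E := [set t | _]; move=> [t0 Et0].
have E0 : E !=set0 by exists t0.
have lbE : lbound E 0 by move=> t [].
have infE : has_inf E by split => //; exists 0.
exists (inf E); last by rewrite ereal_inf_EFin//; exists 0.
have i0 : 0 <= inf E by exact: lb_le_inf.
have ilb t : E t -> inf E <= t by move=> Et; apply: ge_inf => //; exists 0.
have gi : g (inf E) = a \/ g (inf E) = b.
  apply: contrapT => /not_orP[/eqP na /eqP nb].
  have e0 : 0 < Num.min `|g (inf E) - a| `|g (inf E) - b|.
    by rewrite lt_min !normr_gt0 !subr_eq0 na.
  have [r r0 hr] := continuous_dist (inf E) cg e0.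
  have [t Et tr] := inf_adherent r0 infE.
  have := hr t; rewrite ltr_norml lt_min => H.
  have it := ilb t Et.
  have /H/andP[h1 h2] : - r < inf E - t < r by apply/andP; split; lra.
  by case: Et => _ [e|e]; rewrite e ltxx in h1 h2.
have i00 : 0 < inf E.
  rewrite lt_neqAle i0 andbT; apply/eqP => e.
  by move: gi; rewrite -e g00 => -[] e'; lra.
split => // t t_ge0 ti.
have nE s : 0 <= s -> s <= t -> g s <> a /\ g s <> b.
  move=> s0 st; split=> e.
    by have /ilb : E s by [split => //; left]; lra.
  by have /ilb : E s by [split => //; right]; lra.
have wc : {within `[0, t], continuous g} by exact: continuous_subspaceT.
apply/andP; split; rewrite ltNge; apply/negP => h.
  have [|c] := @IVT R g 0 t a t_ge0 wc.
    rewrite g00 ge_min le_max (ltW a0) h orbT /=; done.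
  rewrite in_itv /= => /andP[c0 ct] gc.
  by have [] := nE c c0 ct.
have [|c] := @IVT R g 0 t b t_ge0 wc.
  rewrite g00 ge_min le_max (ltW b0) h orbT /=; done.
rewrite in_itv /= => /andP[c0 ct] gc.
by have [] := nE c c0 ct.
Qed.

Variable tau : R.
Hypothesis ftau : is_first_exit tau.

(** Separates the path at a time [th] before [tau]: up to [th] it keeps a distance [e0] from the
    barriers, so it cannot leave the narrowed interval; after [th] it stays away from 0, so the
    local time no longer grows. *)
Lemma exit_away_from0 : exists th eta e0, [/\ 0 <= th, th < tau, 0 < eta, 0 < e0 &
  (forall t, th <= t <= tau -> eta <= `|g t|) /\
  (forall t, 0 <= t <= th -> a + e0 <= g t <= b - e0)].
Proof.
have ha := a0; have hb := b0.
have [tau0 gtau gin] := ftau.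
have gt0 : 0 < `|g tau| / 2.
  by rewrite divr_gt0// normr_gt0; case: gtau => ->; lra.
have [r r0 hr] := continuous_dist (tau) cg gt0.
(* Time 0 is not within [r] of [tau], because [g 0 = 0] is at distance [|g tau|] from [g tau]. *)
have rt : r <= tau.
  rewrite leNgt; apply/negP => h.
  have := hr 0; rewrite subr0 g00 subr0 gtr0_norm// => /(_ h).
  by have := normr_ge0 (g tau); lra.
have wc : {within `[0, tau - r / 2], continuous g} by exact: continuous_subspaceT.
have t0 : 0 <= tau - r / 2 by lra.
have [c1] := EVT_max t0 wc; rewrite in_itv /= => /andP[c10 c1t] hc1.
have [c2] := EVT_min t0 wc; rewrite in_itv /= => /andP[c20 c2t] hc2.
have /andP[g1 g2] : a < g c1 < b by apply: gin => //; lra.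
have /andP[g3 g4] : a < g c2 < b by apply: gin => //; lra.
exists (tau - r / 2), (`|g tau| / 2), (Num.min (g c2 - a) (b - g c1)).
split => //; [lra|by rewrite lt_min; apply/andP; split; lra|split].
  move=> t /andP[t1 t2].
  have h : `|g tau - g t| < `|g tau| / 2.
    by apply: hr; rewrite ltr_norml; apply/andP; split; lra.
  have := ler_normD (g tau - g t) (g t); rewrite subrK; lra.
move=> t ti.
have h1 := hc1 t; have h2 := hc2 t; rewrite in_itv /= ti in h1 h2.
have := h1 isT; have := h2 isT => h3 h4.
have e1 : Num.min (g c2 - a) (b - g c1) <= g c2 - a by rewrite ge_min lexx.
have e2 : Num.min (g c2 - a) (b - g c1) <= b - g c1 by rewrite ge_min lexx orbT.
by apply/andP; split; lra.
Qed.

(** Ensures that a grid finer than [k] has a point outside the narrowed interval no later than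
    [tau]. *)
Lemma exit_near_boundary d : 0 < d -> exists2 k, 0 < k &
  forall t, tau - k < t -> t <= tau -> ~~ ((a + d < g t) && (g t < b - d)).
Proof.
have ha := a0; have hb := b0.
move=> d0; have [tau0 gtau gin] := ftau.
have [r r0 hr] := continuous_dist (tau) cg d0.
exists r => // t t1 t2.
have rr : - r < tau - t < r by apply/andP; split; lra.
have := hr t; rewrite !ltr_norml => /(_ rr)/andP[h1 h2].
by apply/negP => /andP[h3 h4]; case: gtau => e; lra.
Qed.

Section det_walk.
Context dd (T : measurableType dd) (X : nat -> T -> R) (t : T) (h d : R).
Hypothesis h0 : 0 < h.
Hypothesis Xg : forall i, X i t = g (i.+1%:R * h) - g (i%:R * h).

Lemma walk_path k :
  (forall j, (j < k)%N -> (a + d < g (j%:R * h)) && (g (j%:R * h) < b - d)) ->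
  walk a b X h d k t = (g (k%:R * h), \sum_(j < k) h * trap d (g (j%:R * h))).
Proof.
elim: k => [_|k IH Hk]; first by rewrite /walk /= big_ord0 mul0r g00.
rewrite /walk /= -/(walk a b X h d k t) IH; last first.
  by move=> j jk; apply: Hk; rewrite ltnW.
rewrite /walk_step /= Hk// big_ord_recr /= Xg; congr (_, _); ring.
Qed.

Lemma walk_frozen k n :
  ~~ ((a + d < (walk a b X h d k t).1) && ((walk a b X h d k t).1 < b - d)) ->
  walk a b X h d (k + n) t = walk a b X h d k t.
Proof.
move=> Hk; elim: n => [|n IH]; first by rewrite addn0.
by rewrite addnS /walk /= -/(walk a b X h d (k + n) t) IH /walk_step /= (negbTE Hk).
Qed.

End det_walk.

Lemma continuous_trap d : continuous (@trap R d).
Proof.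
have cr : continuous (@ramp R).
  move=> x; apply: continuous_max; [exact: cvg_id|exact: cvg_cst].
have cs (c : R) : continuous (fun x : R => ramp (x + c)).
  move=> x; apply: (@continuous_comp _ _ _ (fun x : R => x + c) ramp).
    by apply: cvgD; [exact: cvg_id|exact: cvg_cst].
  exact: cr.
move=> x; apply: cvgM; last exact: cvg_cst.
apply: cvgD; last exact: (cs (- d)).
apply: cvgB; last exact: (cs (- (d - d ^+ 2))).
by apply: cvgB; exact: cs.
Qed.

Lemma continuous_trap_path d : continuous (trap d \o g).
Proof. by move=> x; apply: continuous_comp; [exact: cg|exact: continuous_trap]. Qed.

(** A grid may jump over [tau], but with the interval narrowed by [d] the walk stops at a grid time
    in []th, tau]]. There the position is still in [[a, b]], within [d] of a barrier, and the clock
    misses nothing, the kernel vanishing along the path from then to [tau]. *)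
Lemma exit_walk : exists2 D0, 0 < D0 & forall d, 0 < d -> d < D0 ->
  forall M, tau <= M -> forall e, 0 < e -> exists N0, forall N, (N0 <= N)%N ->
  forall dd (T : measurableType dd) (X : nat -> T -> R) t,
  let h := M / N.+1%:R in
  (forall i, X i t = g (i.+1%:R * h) - g (i%:R * h)) ->
  let u := walk a b X h d N.+1 t in
  ((b - d <= u.1 <= b) \/ (a <= u.1 <= a + d)) /\
  `|u.2 - \int[mu]_(s in `[0, tau]) trap d (g s)| <= e.
Proof.
have ha := a0; have hb := b0; have [tau0 gtau gin] := ftau.
have [th [eta [e0 [th0 tht eta0 e00 [g1 g2]]]]] := exit_away_from0.
exists (Num.min 1 (Num.min eta e0)); first by rewrite !lt_min ltr01 eta0.
move=> d d0; rewrite !lt_min => /andP[d1 /andP[deta de0]] M tM e epos.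
have [k k0 hk] := exit_near_boundary d0.
have e'0 : 0 < e / (tau + 1) by rewrite divr_gt0//; lra.
have cv := @continuous_trap_path d.
have [q q0 hq] := uniformly_continuous_segment M cv e'0.
pose r := Num.min q (k / 2).
have r0 : 0 < r by rewrite lt_min q0 divr_gt0.
exists (Num.truncn (M / r)) => N NN dd T X t h Xg u.
have M0 : 0 < M by lra.
have h0 : 0 < h by rewrite /h divr_gt0.
have hr : h < r.
  rewrite /h ltr_pdivrMr// mulrC -ltr_pdivrMr//.
  by apply: (lt_le_trans (truncnS_gt _)); rewrite ler_nat.
move: hr; rewrite lt_min => /andP[hq' hk'].
pose out j := ~~ ((a + d < g (j%:R * h)) && (g (j%:R * h) < b - d)).
(* [js] is the last grid index not after [tau]; it is outside the narrowed interval. [rho] below is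
   the first such index, hence [rho <= js]. *)
pose js := Num.truncn (tau / h).
have js1 : js%:R * h <= tau.
  by rewrite -ler_pdivlMr// truncn_le divr_ge0// ltW.
have js2 : tau < js.+1%:R * h by rewrite -ltr_pdivrMr// truncnS_gt.
have ojs : out js.
  by apply: hk => //; move: js2; rewrite -natr1 mulrDl mul1r; lra.
have [rho orho rhomin] := ex_minnP (ex_intro out js ojs).
have rhojs : (rho <= js)%N by exact: rhomin.
have rhot : rho%:R * h <= tau.
  by apply: le_trans js1; rewrite ler_pM2r// ler_nat.
have inr j : (j < rho)%N -> (a + d < g (j%:R * h)) && (g (j%:R * h) < b - d).
  move=> jr; apply: contraT => oj; have := rhomin j oj.
  by rewrite leqNgt jr.
have rh0 : 0 <= rho%:R * h by rewrite mulr_ge0// ltW.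
have rth : th < rho%:R * h.
  rewrite ltNge; apply/negP => hh.
  have /andP[h1 h2] : a + e0 <= g (rho%:R * h) <= b - e0 by apply: g2; rewrite rh0.
  by move: orho; rewrite /out => /negP[]; apply/andP; split; lra.
have rhoN : (rho <= N.+1)%N.
  rewrite -(ler_nat R) -(ler_pM2r h0); apply: (le_trans rhot).
  by rewrite /h mulrC divfK ?(le_trans tM)// pnatr_eq0.
have wr := walk_path Xg inr.
have uE : u = walk a b X h d rho t.
  rewrite /u -(subnKC rhoN); apply: walk_frozen; rewrite wr; exact: orho.
rewrite uE wr /=; split.
  have gab : a <= g (rho%:R * h) <= b.
    move: rhot; rewrite le_eqVlt => /orP[/eqP ->|rt].
      by case: gtau => ->; apply/andP; split; lra.
    by have /andP[? ?] := gin _ rh0 rt; apply/andP; split; lra.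
  move: orho gab; rewrite /out negb_and -!leNgt => /orP[v1|v1] /andP[v2 v3].
    by right; rewrite v2 v1.
  by left; rewrite v3 v1.
have := riemann_sum_dist cv h0 _ (k := rho).
move=> /(_ M (e / (tau + 1))) H.
have {}H := H (fun x y xM xy => hq x y xM (le_trans xy (ltW hq'))) (le_trans rhot tM).
have <- : \int[mu]_(s in `[0, rho%:R * h]) trap d (g s) =
          \int[mu]_(s in `[0, tau]) trap d (g s).
  have := @Rintegral_itvB R (trap d \o g) (BLeft 0) (BRight tau) (rho%:R * h).
  move=> /(_ (integrable_continuous_itv _ _ cv)); rewrite !bnd_simp => /(_ rh0 rhot) E.
  apply/esym/eqP; rewrite -subr_eq0; apply/eqP; rewrite [LHS]E.
  transitivity (\int[mu]_(x in `]rho%:R * h, tau]) (0 : R)); last first.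
    by rewrite Rintegral_cst//= mul0r.
  apply: eq_Rintegral => x; rewrite inE /= in_itv /= => /andP[x1 x2].
  apply: trap_out => //; first exact: ltW.
  by apply: (le_trans (ltW deta)); apply: g1; rewrite x2 andbT; lra.
apply: (le_trans H).
have e2 : e / (tau + 1) * (tau + 1) = e by rewrite divfK//; lra.
have e3 : rho%:R * h * (e / (tau + 1)) <= tau * (e / (tau + 1)) by rewrite ler_pM2r.
lra.
Qed.

(** The kernel lies below the normalized box of half-width [d] and above [1 - d] times the one of
    half-width [d - d ^+ 2], since [(1 - d) / (2 * (d - d ^+ 2)) = 1 / (2 * d)]. *)
Lemma integral_trap_local_time (l : R) :
  (2 * delta)^-1 * (\int[mu]_(s in `[0, tau]) \1_[set u : R | `|g u| < delta] s)
    @[delta --> 0^'+] --> l ->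
  forall e, 0 < e -> exists2 D1, 0 < D1 & forall d, 0 < d -> d < D1 ->
    `|\int[mu]_(s in `[0, tau]) trap d (g s) - l| <= e.
Proof.
set box := fun delta => _ => hl e epos.
pose e1 := Num.min (e / 2) 1.
have e10 : 0 < e1 by rewrite lt_min divr_gt0//=.
have /cvgrPdist_lt /(_ e1 e10) := hl.
rewrite near_withinE => /nbhs_ballP[r /= r0 hr].
pose D1 := Num.min (Num.min 1 r) (e / (2 * (`|l| + 1))).
have l1 : 0 < `|l| + 1 by have := normr_ge0 l; lra.
exists D1; first by rewrite !lt_min ltr01 r0/= divr_gt0// mulr_gt0.
move=> d d0; rewrite !lt_min => /andP[/andP[d1 dr] de].
have d2 : 0 < d ^+ 2 by rewrite exprn_gt0.
have d2d : d ^+ 2 < d by rewrite expr2; nra.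
have cv := @continuous_trap_path d.
have iv := integrable_continuous_itv 0 tau cv.
have mind delta : measurable [set u : R | `|g u| < delta].
  apply: open_measurable.
  rewrite (_ : [set u | _] = g @^-1` (ball 0 delta)).
    by apply: open_comp; [move=> ? _; exact: cg|exact: ball_open].
  by apply/seteqP; split => u /=; rewrite /ball /= sub0r normrN.
have iind delta : mu.-integrable `[0, tau] (EFin \o (\1_[set u : R | `|g u| < delta] : R -> R)).
  apply: (le_integrable _ _ _ (integrable_continuous_itv 0 tau (@cst_continuous R R 1))) => //.
  - apply/measurable_EFinP; apply: measurable_funTS.
    exact: (measurable_indic (mind delta)).
  - by move=> x _ /=; rewrite lee_fin indicE normr1; case: (_ \in _); rewrite ?normr1 ?normr0.
have iZ (c : R) delta : mu.-integrable `[0, tau] (EFin \o (fun x => c * (\1_[set u : R | `|g u| < delta] x : R))).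
  have := integrableZl (measurable_itv `[0, tau] : measurable (_ : set (measurableTypeR R))) c (iind delta).
  by apply: eq_integrable => // x _; rewrite /= EFinM.
have ub : \int[mu]_(s in `[0, tau]) trap d (g s) <= box d.
  rewrite /box -RintegralZl//.
  apply: le_Rintegral => //.
  move=> s _; rewrite indicE; have [hs|hs] := boolP (_ \in _).
    by rewrite mulr1 trap_le// ltW.
  rewrite mulr0 trap_out//; first exact: ltW.
  move: hs; rewrite notin_setE /= => /negP.
  by rewrite -leNgt.
have lb : (1 - d) * box (d - d ^+ 2) <= \int[mu]_(s in `[0, tau]) trap d (g s).
  rewrite /box mulrA -RintegralZl//.
  apply: le_Rintegral => //.
  move=> s _; rewrite indicE; have [hs|hs] := boolP (_ \in _).
    rewrite mulr1 trap_in//; [|exact: ltW|by move: hs; rewrite inE /= => /ltW].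
    rewrite le_eqVlt; apply/orP; left; apply/eqP.
    by field; nz.
  by rewrite mulr0 trap_ge0// ltW.
have h1 : `|l - box d| < e1.
  by apply: hr => //; rewrite /ball /= sub0r normrN gtr0_norm.
have h2 : `|l - box (d - d ^+ 2)| < e1.
  apply: hr => //; last by rewrite subr_gt0.
  by rewrite /ball /= sub0r normrN gtr0_norm; lra.
move: de; rewrite ltr_pdivlMr; last by rewrite mulr_gt0.
move=> de.
have e11 : e1 <= e / 2 by rewrite ge_min lexx.
have e12 : e1 <= 1 by rewrite ge_min lexx orbT.
have ll : l <= `|l| by exact: ler_norm.
move: h1 h2; rewrite !ltr_norml ler_norml => /andP[h1 h1'] /andP[h2 h2'].
set I := \int[mu]_(s in _) _ in ub lb *.
apply/andP; split; last lra.
have hb : d * box (d - d ^+ 2) <= d * (`|l| + 1) by rewrite ler_pM2l//; lra.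
lra.
Qed.

End exit_paths.

(** * Iterated limits *)

Section limsup.
Context {R : realType}.

Lemma limn_esup_le (u : nat -> \bar R) (c : \bar R) n0 :
  (forall n, (n0 <= n)%N -> (u n <= c)%E) -> (limn_esup u <= c)%E.
Proof.
move=> uc; rewrite /limn_esup /limf_esup.
apply: (@le_trans _ _ (ereal_sup (u @` [set n | (n0 <= n)%N]))).
  apply: ereal_inf_lbound; exists [set n | (n0 <= n)%N] => //.
  by exists n0.
by apply: ge_ereal_sup => _ [n /= nn <-]; exact: uc.
Qed.

Lemma limn_esup_ge (u : nat -> \bar R) (c : \bar R) n0 :
  (forall n, (n0 <= n)%N -> (c <= u n)%E) -> (c <= limn_esup u)%E.
Proof.
move=> uc; rewrite /limn_esup /limf_esup.
apply: le_ereal_inf_tmp => _ [V [n1 _ Vn1] <-].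
apply: (le_trans (uc (maxn n0 n1) (leq_maxl _ _))).
apply: ereal_sup_ubound; exists (maxn n0 n1) => //.
by apply: Vn1 => /=; exact: leq_maxr.
Qed.

End limsup.

Section iterated_limits.
Context d (T : measurableType d) (R : realType) (P : probability T R).

(** The inner limit need not exist: the values only have to stay within [e] of [l t] for [N] large,
    with a threshold depending on [n] and on the point [t]. *)
Definition iterated_limit (f : nat -> nat -> T -> R) (l : T -> R) (t : T) :=
  forall e : R, 0 < e -> exists n0, forall n, (n0 <= n)%N ->
    exists N0, forall N, (N0 <= N)%N -> `|f n N t - l t| <= e.

(** An iterated upper limit is measurable and agrees with [l] wherever the iterated limit holds. *)
Lemma iterated_limit_RV (f : nat -> nat -> T -> R) (l : T -> R) :
  (forall n N, measurable_fun setT (f n N)) ->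
  {ae P, forall t, iterated_limit f l t} ->
  exists Y : {RV P >-> R}, {ae P, forall t, Y t = l t}.
Proof.
move=> mf fl.
pose Z t := limn_esup (fun n => limn_esup (fun N => (f n N t)%:E)).
have mZ : measurable_fun setT Z.
  apply: measurable_fun_limn_esup => n; apply: measurable_fun_limn_esup => N.
  exact/measurable_EFinP.
have mY : measurable_fun setT (fine \o Z) by apply: measurableT_comp.
pose Y : {mfun T >-> R} := HB.pack (fine \o Z) (isMeasurableFun.Build _ _ _ _ _ mY).
exists Y; apply: filterS fl => t ft; rewrite /Y /=.
suff -> : Z t = (l t)%:E by [].
apply/eqP; rewrite eq_le; apply/andP; split.
  apply/lee_addgt0Pr => e e0.
  have [n0 H] := ft e e0.
  apply: (limn_esup_le (n0 := n0)) => n nn; have [N0 HN] := H n nn.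
  apply: (limn_esup_le (n0 := N0)) => N NN.
  have := HN N NN; rewrite ler_distl => /andP[_ h].
  by rewrite -EFinD lee_fin.
apply/lee_addgt0Pr => e e0.
have [n0 H] := ft e e0.
rewrite -leeBlDr// -EFinB.
apply: (limn_esup_ge (n0 := n0)) => n nn; have [N0 HN] := H n nn.
apply: (limn_esup_ge (n0 := N0)) => N NN.
have := HN N NN; rewrite ler_distl => /andP[h _].
by rewrite lee_fin.
Qed.

(** Dominated convergence twice: the inner upper limits [g n] tend to 0, and for fixed [n] the
    suprema [s n N] of the tails, which dominate [f n N], decrease to [g n]. *)
Lemma iterated_dominated_convergence (f : nat -> nat -> T -> R) (C : R) :
  (forall n N, measurable_fun setT (f n N)) ->
  (forall n N t, 0 <= f n N t <= C) ->
  {ae P, forall t, iterated_limit f (fun=> 0) t} ->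
  forall e : R, 0 < e -> exists n0, forall n, (n0 <= n)%N ->
    exists N0, forall N, (N0 <= N)%N -> \int[P]_t f n N t <= e.
Proof.
move=> mf f0C fl e e0.
pose s n N t := esups (fun M => (f n M t)%:E) N.
pose g n t := limn_esup (fun N => (f n N t)%:E).
have ms n N : measurable_fun setT (s n N).
  by apply: measurable_fun_esups => M; exact/measurable_EFinP.
have mg n : measurable_fun setT (g n).
  by apply: measurable_fun_limn_esup => M; exact/measurable_EFinP.
have s0C n N t : (0 <= s n N t <= C%:E)%E.
  apply/andP; split.
    apply: (@le_trans _ _ (f n N t)%:E).
      by rewrite lee_fin; have /andP[] := f0C n N t.
    by apply: ereal_sup_ubound; exists N => /=.
  apply: ge_ereal_sup => _ [M /= _ <-].
  by rewrite lee_fin; have /andP[] := f0C n M t.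
have g0C n t : (0 <= g n t <= C%:E)%E.
  apply/andP; split.
    apply: (limn_esup_ge (n0 := 0%N)) => N _.
    by rewrite lee_fin; have /andP[] := f0C n N t.
  apply: (limn_esup_le (n0 := 0%N)) => N _.
  by rewrite lee_fin; have /andP[] := f0C n N t.
have iC : P.-integrable setT (EFin \o (cst C : T -> R)).
  exact: finite_measure_integrable_cst.
have gl : {ae P, forall t, setT t -> g ^~ t @ \oo --> (cst 0%E : T -> \bar R) t}.
  apply: filterS fl => t ft _.
  apply/fine_cvgP; split.
    apply: nearW => n; have /andP[g0 gC] := g0C n t.
    by rewrite ge0_fin_numE// (le_lt_trans gC)// ltry.
  apply/cvgrPdist_le => r r0; have [n0 H] := ft r r0.
  exists n0 => // n /= nn; rewrite sub0r normrN.
  have /andP[g0 gC] := g0C n t.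
  rewrite ger0_norm ?fine_ge0//.
  rewrite -lee_fin fineK; last by rewrite ge0_fin_numE// (le_lt_trans gC)// ltry.
  have [N0 HN] := H n nn.
  apply: (limn_esup_le (n0 := N0)) => N NN; rewrite lee_fin.
  by apply: (le_trans (ler_norm _)); have := HN N NN; rewrite subr0.
have gb : {ae P, forall t n, setT t -> (`|g n t| <= (EFin \o cst C) t)%E}.
  by apply: aeW => t n _ /=; have /andP[? ?] := g0C n t; rewrite gee0_abs.
have [_ _ cg] := dominated_convergence measurableT mg (measurable_cst _) gl iC gb.
have {}cg : ((fun n => \int[P]_t g n t) @ \oo --> 0)%E.
  by move: cg; rewrite integral0.
have fing n : (\int[P]_t g n t)%E \is a fin_num.
  apply: integrable_fin_num => //; apply: le_integrable iC => //.
  by move=> t _ /=; have /andP[? ?] := g0C n t; rewrite gee0_abs//; apply: (@le_trans _ _ C%:E) => //=; rewrite lee_fin ler_norm.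
have e20 : 0 < e / 2 by rewrite divr_gt0.
have /fine_cvgP[_ /cvgrPdist_lt /(_ (e / 2) e20)] := cg.
move=> [n0 _ Hn0]; exists n0 => n nn.
have hgn : (\int[P]_t g n t < (e / 2)%:E)%E.
  have := Hn0 n nn; rewrite /= sub0r normrN => h.
  rewrite -(fineK (fing n)) lte_fin; exact: (le_lt_trans (ler_norm _)).
have sl : {ae P, forall t, setT t -> s n ^~ t @ \oo --> g n t}.
  apply: aeW => t _; rewrite /g limn_esup_lim.
  exact: is_cvg_esups.
have sb : {ae P, forall t N, setT t -> (`|s n N t| <= (EFin \o cst C) t)%E}.
  by apply: aeW => t N _ /=; have /andP[? ?] := s0C n N t; rewrite gee0_abs.
have [_ _ cs] := dominated_convergence measurableT (ms n) (mg n) sl iC sb.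
have /fine_cvgP[fs /cvgrPdist_lt /(_ (e / 2) e20)] : ((fun N => \int[P]_t s n N t) @ \oo -->
    (fine (\int[P]_t g n t))%:E)%E.
  by rewrite fineK.
move=> [N0 _ HN0]; exists N0 => N NN.
have hs := HN0 N NN; rewrite /= in hs.
have fins : (\int[P]_t s n N t)%E \is a fin_num.
  apply: integrable_fin_num => //; apply: le_integrable iC => //.
  by move=> t _ /=; have /andP[? ?] := s0C n N t; rewrite gee0_abs//; apply: (@le_trans _ _ C%:E) => //=; rewrite lee_fin ler_norm.
apply: (@le_trans _ _ (fine (\int[P]_t s n N t)%E)).
  rewrite /Rintegral; apply: fine_le => //.
    apply: integrable_fin_num => //; apply: (@integrable_bounded _ _ _ P _ C) => //.
    by move=> t; have /andP[? ?] := f0C n N t; rewrite ger0_norm.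
  apply: ge0_le_integral => //.
  - by move=> t _; rewrite lee_fin; have /andP[] := f0C n N t.
  - exact/measurable_EFinP.
  - by move=> t _; apply: ereal_sup_ubound; exists N => /=.
move: hs; rewrite ltr_norml => /andP[h1 h2].
have : fine (\int[P]_t g n t)%E < e / 2 by rewrite -lte_fin fineK.
lra.
Qed.

End iterated_limits.

(** * Brownian paths *)

Section brownian.
Context d (T : measurableType d) (R : realType) (P : probability T R).
Variables (w : R -> {RV P >-> R}) (L : R -> T -> R) (a b : R).
Hypotheses (a0 : a < 0) (b0 : 0 < b).
Hypothesis hw : standard_brownian_motion P w.
Hypothesis hL : is_local_time0 P w L.

Local Notation m := (exit_mean a b).
Notation mu := (@lebesgue_measure R).

Definition bm_incr (h : R) (i : nat) (t : T) : R := w (i.+1%:R * h) t - w (i%:R * h) t.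

Lemma measurable_bm_incr h i : measurable_fun setT (bm_incr h i).
Proof. exact: measurable_funB. Qed.

Lemma bm_incr_indep h N : 0 < h -> mutually_independent P (fun i : 'I_N => bm_incr h i).
Proof.
move=> h0; have := @sbm_indep _ _ _ _ _ hw (fun i => i%:R * h) N.
apply; first by rewrite mul0r.
by move=> i; rewrite ler_pM2r// ler_nat.
Qed.

Lemma bm_incr_law h k B : 0 < h -> measurable B ->
  P (bm_incr h k @^-1` B) = normal_prob 0 (Num.sqrt h) B.
Proof.
move=> h0 mB.
have := @sbm_gauss _ _ _ _ _ hw (k%:R * h) (k.+1%:R * h) _ _ B mB.
have -> : k.+1%:R * h - k%:R * h = h by rewrite -natr1; ring.
apply; first by rewrite mulr_ge0// ltW.
by rewrite ltr_pM2r// ltr_nat.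
Qed.

(** A path that never meets [a] or [b] is in []a, b[] at all integer times, by the intermediate
    value theorem. At time [n.+1] this has probability at most the length [b - a] times the peak of
    the density, which tends to 0. *)
Lemma ae_exit : {ae P, forall t, exists s, 0 <= s /\ (w s t = a \/ w s t = b)}.
Proof.
have ha := a0; have hb := b0.
pose I n := (fun t => w n.+1%:R t - w 0 t) @^-1` `]a, b[%classic.
have mI n : measurable (I n).
  rewrite -[X in measurable X]setTI.
  have mf : measurable_fun setT (fun t => w n.+1%:R t - w 0 t).
    exact: measurable_funB.
  exact: mf.
have PI n : (P (I n) <= ((b - a) * normal_peak (Num.sqrt n.+1%:R))%:E)%E.
  have := @sbm_gauss _ _ _ _ _ hw 0 n.+1%:R (lexx _) (ltr0Sn _ _) `]a, b[%classic.
  rewrite subr0 => /(_ (measurable_itv _)) E.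
  rewrite /I [X in (X <= _)%E]E /normal_prob.
  have s0 : Num.sqrt n.+1%:R != 0 :> R by rewrite gt_eqF// sqrtr_gt0.
  apply: (@le_trans _ _ (\int[mu]_(x in `]a, b[) (normal_peak (Num.sqrt (n.+1%:R : R)))%:E)%E).
    apply: ge0_le_integral => //.
    - by move=> x _; rewrite lee_fin normal_pdf_ge0.
    - apply/measurable_EFinP; apply: measurable_funTS; exact: measurable_normal_pdf.
    - by move=> x _; rewrite lee_fin normal_pdf_ub.
  rewrite integral_cst//= lebesgue_measure_itv /= lte_fin ifT; last lra.
  by rewrite -EFinD -EFinM mulrC.
have PI0 : P (\bigcap_n I n) = 0%E.
  apply/eqP; rewrite eq_le measure_ge0 andbT.
  apply/lee_addgt0Pr => e e0; rewrite add0e.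
  pose c := (b - a) / e.
  have c0 : 0 < c by rewrite divr_gt0//; lra.
  pose n := Num.truncn (c ^+ 2).
  apply: (@le_trans _ _ (P (I n))).
    apply: le_measure; rewrite ?inE//; first exact: bigcapT_measurable.
    by move=> t; apply.
  apply: (le_trans (PI n)); rewrite lee_fin.
  have nc : c ^+ 2 < n.+1%:R by exact: truncnS_gt.
  rewrite /normal_peak sqr_sqrtr//.
  have sc : c <= Num.sqrt (n.+1%:R * pi *+ 2).
    rewrite -[leLHS](ger0_norm (ltW c0)) -sqrtr_sqr ler_wsqrtr//.
    apply: (le_trans (ltW nc)); rewrite -mulrnAr ler_peMr//.
    by have := pi_ge2 R; rewrite mulr2n; lra.
  rewrite ler_pdivrMr; last exact: (lt_le_trans c0 sc).
  by rewrite mulrC -ler_pdivrMr.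
have [A [mA PA0 hA]] := sbm_start hw.
have [B [mB PB0 hB]] := sbm_continuous hw.
exists (\bigcap_n I n `|` (A `|` B)); split.
- by apply: measurableU; [exact: bigcapT_measurable|exact: measurableU].
- by apply: null_set_setU => //; [exact: bigcapT_measurable|exact: measurableU|exact: null_set_setU].
move=> t /= nt; apply: contrapT => /not_orP[nI /not_orP[nA nB]].
apply: nt.
have w0 : w 0 t = 0 by apply: contrapT => h; apply: nA; exact: hA.
have wc : {within `[0, +oo[, continuous (fun s : R => w s t)}.
  by apply: contrapT => h; apply: nB; exact: hB.
have cg := continuous_extension wc; set g := (fun s => _) in cg.
have [n nIn] : exists n, ~ I n t.
  by apply: contrapT => /forallNP h; apply: nI => n _; apply: contrapT; exact: h.
have wc' : {within `[0, n.+1%:R], continuous g} by exact: continuous_subspaceT.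
have g0 : g 0 = 0 by rewrite /g maxxx.
have gn : g n.+1%:R = w n.+1%:R t by rewrite /g max_l.
have {}nIn : (g n.+1%:R <= a) \/ (b <= g n.+1%:R).
  move: nIn; rewrite /I /= in_itv /= w0 subr0 -gn => /negP.
  by rewrite negb_and -!leNgt => /orP[h|h]; [left|right].
case: nIn => hn.
  have [|c] := @IVT R g 0 n.+1%:R a (ler0n _ _) wc'.
    rewrite g0 ge_min le_max hn (ltW a0) orbT /=; done.
  rewrite in_itv /= => /andP[c0 _] gc; exists c; split => //; left.
  by rewrite -gc /g max_l.
have [|c] := @IVT R g 0 n.+1%:R b (ler0n _ _) wc'.
  rewrite g0 ge_min le_max hn (ltW b0) orbT /=; done.
rewrite in_itv /= => /andP[c0 _] gc; exists c; split => //; right.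
by rewrite -gc /g max_l.
Qed.

Definition grid_step (n N : nat) : R := n.+1%:R / N.+1%:R.

(** The index [n] governs both the kernel width [1 / n.+1] and the time horizon [n.+1], so that the
    horizon eventually exceeds [tau]; [N] governs the mesh. *)
Definition bm_walk (n N : nat) (t : T) : R * R :=
  walk a b (bm_incr (grid_step n N)) (grid_step n N) n.+1%:R^-1 N.+1 t.

Lemma grid_step_gt0 n N : 0 < grid_step n N.
Proof. by rewrite divr_gt0. Qed.

Lemma measurable_bm_walk n N : measurable_fun setT (bm_walk n N).
Proof. by apply: measurable_walk; exact: measurable_bm_incr. Qed.

Definition local_time_at_exit (t : T) : R := L (fine (hitting_time w a b t)) t.

Lemma small_inv (D : R) : 0 < D -> exists n0, forall n, (n0 <= n)%N -> n.+1%:R^-1 < D.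
Proof.
move=> D0; exists (Num.truncn D^-1) => n nn.
rewrite invf_plt ?posrE//; apply: (lt_le_trans (truncnS_gt _)).
by rewrite ler_nat.
Qed.

(** [exit_walk] and [integral_trap_local_time] on each path. The thresholds depend on the path
    through [tau] and its distances to 0 and to the barriers. *)
Lemma ae_bm_walk_limit : {ae P, forall t,
  iterated_limit (fun n N t => (bm_walk n N t).2) local_time_at_exit t /\
  iterated_limit (fun n N t => ctent a b n.+1%:R^-1 (bm_walk n N t).1) (fun=> 1) t}.
Proof.
have ha := a0; have hb := b0.
have h1 := sbm_start hw; have h2 := sbm_continuous hw.
near=> t.
have w0 : w 0 t = 0 by near: t; exact: h1.
have wc : {within `[0, +oo[, continuous (fun s : R => w s t)} by near: t; exact: h2.
have [s1 [s10 ws1]] : exists s, 0 <= s /\ (w s t = a \/ w s t = b) by near: t; exact: ae_exit.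
have Lt : forall u : R, 0 <= u ->
    (2 * delta)^-1 * (\int[lebesgue_measure]_(s in `[0%R, u])
                        \1_[set u : R | `|w u t| < delta] s)
      @[delta --> 0^'+] --> L u t by near: t; exact: hL.
have cg := continuous_extension wc; set g := (fun s => _) in cg.
have g0 : g 0 = 0 by rewrite /g maxxx.
have gE s : 0 <= s -> g s = w s t by move=> s0; rewrite /g max_l.
have [|tau ftau htau] := first_exitP a0 b0 cg g0.
  by exists s1; rewrite gE.
have Ltau : local_time_at_exit t = L tau t.
  rewrite /local_time_at_exit (_ : hitting_time w a b t = tau%:E)//.
  rewrite -htau /hitting_time; congr (ereal_inf (_ @` _)).
  by apply/seteqP; split => s [/= s0]; rewrite gE.
have [tau0 gtau gin] := ftau.
have ltau := Lt tau (ltW tau0).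
have {}ltau : (2 * delta)^-1 * (\int[mu]_(s in `[0, tau]) \1_[set u : R | `|g u| < delta] s)
    @[delta --> 0^'+] --> L tau t.
  move: ltau; apply: cvg_trans; apply: near_eq_cvg; near=> delta.
  congr (_ * _); apply: eq_Rintegral => s; rewrite inE /= in_itv /= => /andP[s0 _].
  rewrite !indicE; congr (_%:R); congr nat_of_bool; apply/idP/idP; rewrite !inE /= gE//.
have [D0 D00 HD0] := exit_walk a0 b0 cg g0 ftau.
have Xg n N i : bm_incr (grid_step n N) i t =
    g (i.+1%:R * grid_step n N) - g (i%:R * grid_step n N).
  by rewrite !gE ?mulr_ge0// ltW// grid_step_gt0.
split.
  move=> e e0; have e20 : 0 < e / 2 by rewrite divr_gt0.
  have [D1 D10 HD1] := integral_trap_local_time cg ltau e20.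
  have [n1 Hn1] := small_inv D00; have [n2 Hn2] := small_inv D10.
  exists (maxn (Num.truncn tau) (maxn n1 n2)) => n.
  rewrite !geq_max => /andP[nt /andP[nn1 nn2]].
  have d0 : 0 < n.+1%:R^-1 :> R by rewrite invr_gt0.
  have tn : tau <= n.+1%:R.
    by apply/ltW/(lt_le_trans (truncnS_gt _)); rewrite ler_nat.
  have [N0 HN0] := HD0 n.+1%:R^-1 d0 (Hn1 n nn1) n.+1%:R tn (e / 2) e20.
  exists N0 => N NN.
  have [_ hA] := HN0 N NN _ T (bm_incr (grid_step n N)) t (Xg n N).
  have hI := HD1 n.+1%:R^-1 d0 (Hn2 n nn2).
  rewrite Ltau; apply: (le_trans (ler_distD _ _ _)).
  by apply: (le_trans (lerD hA hI)); lra.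
move=> e e0.
pose c := b^-1 + (- a)^-1 + exit_slope a b * b.
have s0 := exit_slope_gt0 a0 b0.
have c0 : 0 < c.
  by rewrite /c !addr_gt0 ?invr_gt0// ?oppr_gt0// mulr_gt0.
have D20 : 0 < Num.min (Num.min D0 1) (Num.min (e / c) (Num.min (b / 2) (- a / 2))).
  by rewrite !lt_min D00 ltr01 !divr_gt0// oppr_gt0.
have [n1 Hn1] := small_inv D20.
exists (maxn (Num.truncn tau) n1) => n.
rewrite !geq_max => /andP[nt nn1].
have d0 : 0 < n.+1%:R^-1 :> R by rewrite invr_gt0.
have := Hn1 n nn1; rewrite !lt_min => /andP[/andP[dD d1] /andP[de /andP[db da]]].
have tn : tau <= n.+1%:R.
  by apply/ltW/(lt_le_trans (truncnS_gt _)); rewrite ler_nat.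
have [N0 HN0] := HD0 n.+1%:R^-1 d0 dD n.+1%:R tn e e0.
exists N0 => N NN.
have [hu _] := HN0 N NN _ T (bm_incr (grid_step n N)) t (Xg n N).
apply: (le_trans (ctent_exit a0 b0 d0 (ltW d1) (ltW db) (ltW da) hu)).
by rewrite -/c mulrC -ler_pdivlMr// ltW.
Unshelve. all: end_near.
Qed.

End brownian.

(** * Stein's equation for the local time at exit *)

Section stein_identity.
Context d (T : measurableType d) (R : realType) (P : probability T R).
Variables (w : R -> {RV P >-> R}) (L : R -> T -> R) (a b : R).
Hypotheses (a0 : a < 0) (b0 : 0 < b).
Hypothesis hw : standard_brownian_motion P w.
Hypothesis hL : is_local_time0 P w L.

Local Notation m := (exit_mean a b).
Local Notation LT := (local_time_at_exit w L a b).
Local Notation W := (bm_walk w a b).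

(** The version is obtained as a limit of the clocks, which are nonnegative. It is made nonnegative
    everywhere, so that the formulas of the test functions on the half-line hold at every point. *)
Lemma ae_local_time_RV : exists2 Y : {RV P >-> R}, (forall t, 0 <= Y t) &
  {ae P, forall t, Y t = LT t}.
Proof.
have lim := ae_bm_walk_limit a0 b0 hw hL.
have mA n N : measurable_fun setT (fun t => (W n N t).2).
  exact: (measurableT_comp measurable_snd (measurable_bm_walk w a b n N)).
have [Y YL] : exists Y : {RV P >-> R}, {ae P, forall t, Y t = LT t}.
  by apply: (iterated_limit_RV mA); apply: filterS lim => t [].
have mY : measurable_fun setT (fun t => Num.max (Y t) 0) by exact: measurable_maxr.
pose Y' : {mfun T >-> R} := HB.pack (fun t => Num.max (Y t) 0)
  (isMeasurableFun.Build _ _ _ _ _ mY).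
exists Y'; first by move=> t; rewrite /Y' /= le_max lexx orbT.
apply: filterS2 lim YL => t [lt _] YLt; rewrite /Y' /= YLt.
apply/max_idPl; rewrite leNgt; apply/negP => h.
have e0 : 0 < - LT t / 2 by rewrite divr_gt0// oppr_gt0.
have [n0 /(_ n0 (leqnn _))[N0 /(_ N0 (leqnn _))]] := lt _ e0.
have A0 : 0 <= (W n0 N0 t).2.
  by apply: walk_ge0; rewrite ?grid_step_gt0 ?invr_gt0// invf_le1// ler1n.
by rewrite ler_norml => /andP[h1 h2]; lra.
Qed.

(** As [N.+1%:R * h] is the horizon [n.+1], the error equals [n.+1 * E * (s + s ^+ 2)] with
    [s = Num.sqrt h]. *)
Lemma cvg_grid_error (n : nat) (E e : R) : 0 <= E -> 0 < e -> exists N0, forall N, (N0 <= N)%N ->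
  N.+1%:R * (E * (Num.sqrt (grid_step R n N) ^+ 3 + grid_step R n N ^+ 2)) <= e.
Proof.
move=> E0 e0; pose M : R := n.+1%:R.
have M0 : 0 < M by rewrite ltr0n.
pose q := Num.min 1 (e / (2 * (E + 1) * M)).
have q0 : 0 < q by rewrite lt_min ltr01 divr_gt0// mulr_gt0// mulr_gt0//; lra.
have r0 : 0 < q ^+ 2 by rewrite exprn_gt0.
exists (Num.truncn (M / q ^+ 2)) => N NN.
set h := grid_step R n N.
have h0 : 0 < h by exact: grid_step_gt0.
have hq : h < q ^+ 2.
  rewrite /h /grid_step ltr_pdivrMr// mulrC -ltr_pdivrMr//.
  by apply: (lt_le_trans (truncnS_gt _)); rewrite ler_nat.
have Nh : N.+1%:R * h = M by rewrite /h /grid_step mulrC divfK// pnatr_eq0.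
set s := Num.sqrt h.
have s0 : 0 < s by rewrite sqrtr_gt0.
have ss : s ^+ 2 = h by rewrite sqr_sqrtr// ltW.
have sq : s <= q.
  by rewrite -[leRHS]ger0_norm ?(ltW q0)// -sqrtr_sqr ler_wsqrtr// ltW.
have q1 : q <= 1 by rewrite ge_min lexx.
have q2 : q <= e / (2 * (E + 1) * M) by rewrite ge_min lexx orbT.
have -> : N.+1%:R * (E * (s ^+ 3 + h ^+ 2)) = (N.+1%:R * h) * (E * (s + s ^+ 2)).
  by rewrite -ss; ring.
rewrite Nh.
have s1 : s <= 1 := le_trans sq q1.
have s2 : s ^+ 2 <= s by rewrite expr2; nra.
have e1 : M * (E * (s + s ^+ 2)) <= M * (E * (2 * q)).
  rewrite ler_pM2l//; apply: ler_wpM2l => //; lra.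
apply: (le_trans e1).
move: q2; rewrite ler_pdivlMr; last by rewrite !mulr_gt0//; lra.
have qM : 0 < q * M by rewrite mulr_gt0.
lra.
Qed.

Lemma stein_identity (Y : {RV P >-> R}) (H K B : R -> R) (C : R) :
  {ae P, forall t, Y t = LT t} ->
  stein_test H K B C -> continuous H -> continuous K ->
  \int[P]_t (H (Y t) - K (Y t) / m) = - K 0 / m.
Proof.
move=> YL st cH cK.
have m0 := exit_mean_gt0 a0 b0.
have [mH mK mB] := stein_measurable st.
have C0 : 0 <= C by have [h _ _] := stein_bounded st 0; exact: le_trans h.
have sl0 := ctent_slope_gt0 a0 b0.
pose Q t := H (Y t) - K (Y t) / m.
have mQ : measurable_fun setT Q.
  apply: measurable_funB; first exact: (measurableT_comp mH).
  by apply: measurable_funM => //; exact: (measurableT_comp mK).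
have bQ t : `|Q t| <= C + C / m.
  have [hH hK _] := stein_bounded st (Y t).
  apply: (le_trans (ler_normB _ _)); apply: lerD => //.
  rewrite normrM [X in _ * X]gtr0_norm ?invr_gt0//.
  by rewrite ler_wpM2r// invr_ge0 ltW.
pose F n N t := stein_fun a b H K n.+1%:R^-1 (W n N t).
have mF n N : measurable_fun setT (F n N).
  apply: (measurableT_comp (f := stein_fun a b H K n.+1%:R^-1)).
    exact: measurable_stein_fun.
  exact: measurable_bm_walk.
have bF n N t : `|F n N t| <= tent_bound a b * C + C / m.
  exact: (stein_fun_le a0 b0 n.+1%:R^-1 (W n N t) st).
pose f n N t := `|F n N t - Q t|.
(* At exit the profile tends to 1 and the clock to the local time, so [F] tends to [Q]. *)
have flim : {ae P, forall t, iterated_limit f (fun=> 0) t}.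
  have lim := ae_bm_walk_limit a0 b0 hw hL.
  apply: filterS2 lim YL => t [lA lc] YLt e e0.
  have e30 : 0 < e / 3 by rewrite divr_gt0.
  have em0 : 0 < m * e / 3 by rewrite divr_gt0// mulr_gt0.
  have eC0 : 0 < e / (3 * (C + 1)) by rewrite divr_gt0// mulr_gt0//; lra.
  have [r1 r10 hr1] := continuous_dist (LT t) cH e30.
  have [r2 r20 hr2] := continuous_dist (LT t) cK em0.
  have r0 : 0 < Num.min r1 r2 / 2 by rewrite divr_gt0// lt_min r10.
  have [n1 Hn1] := lA _ r0; have [n2 Hn2] := lc _ eC0.
  exists (maxn n1 n2) => n; rewrite geq_max => /andP[nn1 nn2].
  have [N1 HN1] := Hn1 n nn1; have [N2 HN2] := Hn2 n nn2.
  exists (maxn N1 N2) => N; rewrite geq_max => /andP[NN1 NN2].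
  have hA := HN1 N NN1; have hc := HN2 N NN2.
  rewrite subr0 /f normr_id /F /Q YLt /stein_fun.
  set A := (W n N t).2 in hA *; set c := ctent _ _ _ _ in hc *.
  have dA : `|LT t - A| < Num.min r1 r2.
    by rewrite distrC; apply: (le_lt_trans hA); lra.
  move: dA; rewrite lt_min => /andP[/hr1 dH /hr2 dK].
  have [hH _ _] := stein_bounded st A.
  have -> : c * H A - K A / m - (H (LT t) - K (LT t) / m) =
    (c - 1) * H A - (H (LT t) - H A) + (K (LT t) - K A) / m by ring.
  have e1 : `|(c - 1) * H A| <= e / 3.
    rewrite normrM; apply: (@le_trans _ _ (e / (3 * (C + 1)) * (C + 1))).
      by apply: ler_pM => //; lra.
    rewrite le_eqVlt; apply/orP; left; apply/eqP; field; lra.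
  have e2 : `|(K (LT t) - K A) / m| <= e / 3.
    rewrite normrM [X in _ * X]gtr0_norm ?invr_gt0// ler_pdivrMr//.
    by apply: (le_trans (ltW dK)); lra.
  apply: (le_trans (ler_normD _ _)).
  have := ler_normB ((c - 1) * H A) (H (LT t) - H A); lra.
have mf n N : measurable_fun setT (f n N).
  by apply: measurableT_comp => //; exact: measurable_funB.
have bf n N t : 0 <= f n N t <= tent_bound a b * C + C / m + (C + C / m).
  rewrite normr_ge0 /=; apply: (le_trans (ler_normB _ _)); exact: lerD.
have dct := iterated_dominated_convergence mf bf flim.
apply/eqP; rewrite -subr_eq0 -normr_le0; apply/ler_addgt0Pr => e e0; rewrite add0r.
have e40 : 0 < e / 4 by rewrite divr_gt0.
have [n1 Hn1] := dct _ e40.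
have D0 : 0 < e / (8 * (ctent_slope a b * (C + 1))).
  by rewrite divr_gt0// !mulr_gt0//; lra.
have [n2 Hn2] := small_inv D0.
(* [n] is fixed before [N], since the constant [E] supplied by [discrete_stein] depends on the
   width. *)
pose n := maxn n1 n2.
have {Hn1}[N1 HN1] := Hn1 n (leq_maxl _ _).
have {}Hn2 := Hn2 n (leq_maxr _ _).
have d0 : 0 < n.+1%:R^-1 :> R by rewrite invr_gt0.
have d1 : n.+1%:R^-1 <= 1 :> R by rewrite invf_le1// ler1n.
have [E E0 HE] := discrete_stein a0 b0 st C0 d0 d1.
have [N2 HN2] := cvg_grid_error n E0 e40.
pose N := maxn N1 N2.
have {}HN1 := HN1 N (leq_maxl _ _); have {}HN2 := HN2 N (leq_maxr _ _).
have HI := HE d T P (bm_incr w (grid_step R n N)) N.+1 (grid_step R n N)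
  (grid_step_gt0 R n N) (fun i => @measurable_bm_incr _ _ _ _ w _ i) (@bm_incr_indep _ _ _ _ _ hw _ _ (grid_step_gt0 R n N))
  (fun k _ B mB => bm_incr_law hw k (grid_step_gt0 R n N) mB).
rewrite -/(bm_walk w a b n N) in HI.
have iF := integrable_bounded P (mF n N) (bF n N).
have iQ := integrable_bounded P mQ bQ.
have I1 : `|\int[P]_t F n N t - \int[P]_t Q t| <= e / 4.
  rewrite -RintegralB//; apply: le_trans HN1; apply: le_normr_Rintegral => //.
  have := integrableB measurableT iF iQ.
  by apply: eq_integrable => // x _; rewrite /= EFinB.
have cs : `|ctent a b n.+1%:R^-1 0| <= ctent_slope a b * n.+1%:R^-1.
  by apply: ctent_small; rewrite ?normr0// ltW.
have hd : ctent_slope a b * n.+1%:R^-1 * (C + 1) <= e / 8.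
  apply: ltW; rewrite ltr_pdivlMr//; move: Hn2.
  rewrite ltr_pdivlMr; last by rewrite !mulr_gt0//; lra.
  by apply: le_lt_trans; rewrite le_eqVlt; apply/orP; left; apply/eqP; ring.
have hd1 : 0 < ctent_slope a b * n.+1%:R^-1 by rewrite mulr_gt0.
have [hH0 _ _] := stein_bounded st 0.
have I3 : `|ctent a b n.+1%:R^-1 0 * H 0| <= e / 8.
  rewrite normrM; apply: le_trans hd; apply: ler_pM => //; lra.
have I2 : `|\int[P]_t F n N t - stein_fun a b H K n.+1%:R^-1 (0, 0)| <= e / 2.
  apply: (le_trans HI); apply: (le_trans (lerD (lexx _) HN2)).
  move: hd hd1; set sd := ctent_slope a b * _ => hd hd1.
  lra.
rewrite /stein_fun /= in I2.
set IF := \int[P]_t F n N t in I1 I2; set IQ := \int[P]_t Q t in I1 *.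
set c0 := ctent _ _ _ _ * _ in I2 I3.
move: I1 I2 I3; rewrite !ler_norml => /andP[? ?] /andP[? ?] /andP[? ?].
by apply/andP; split; lra.
Qed.

End stein_identity.

(** * Test functions *)

Section stein_tests.
Context {R : realType}.

Lemma expR_lower (z : R) : 1 - z <= expR (- z).
Proof. by rewrite -[X in X <= _]/(1 + - z) expR_ge1Dx. Qed.

Lemma expR_upper (z : R) : 0 <= z -> expR (- z) <= 1 - z + z ^+ 2.
Proof.
move=> z0; have h := expR_ge1Dx z.
rewrite expRN -(@ler_pM2l _ (expR z)) ?expR_gt0// divff ?gt_eqF ?expR_gt0//.
have q0 : 0 <= 1 - z + z ^+ 2.
  have -> : 1 - z + z ^+ 2 = (z - 1 / 2) ^+ 2 + 3 / 4 by field.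
  by rewrite addr_ge0// sqr_ge0.
apply: (@le_trans _ _ ((1 + z) * (1 - z + z ^+ 2))); last exact: ler_wpM2r.
have -> : (1 + z) * (1 - z + z ^+ 2) = 1 + z ^+ 3 by ring.
by rewrite lerDl exprn_ge0.
Qed.

Lemma continuous_posexp (c : R) : continuous (fun l : R => expR (c * Num.max l 0)).
Proof.
move=> x; apply: continuous_comp; last exact: continuous_expR.
apply: cvgM; first exact: cvg_cst.
by apply: continuous_max; [exact: cvg_id|exact: cvg_cst].
Qed.

Section laplace_test.
Variables (g : R) (g0 : 0 < g).

Definition laplaceK (l : R) : R := 1 - expR (- g * Num.max l 0).
Definition laplaceH (l : R) : R := g * expR (- g * Num.max l 0).

Lemma continuous_laplaceK : continuous laplaceK.
Proof. by move=> x; apply: cvgB; [exact: cvg_cst|exact: continuous_posexp]. Qed.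

Lemma continuous_laplaceH : continuous laplaceH.
Proof. by move=> x; apply: cvgM; [exact: cvg_cst|exact: continuous_posexp]. Qed.

(** [laplaceH] is nonincreasing, so its opposite measures its own variation. The constant collects
    the bounds 1 on [K], [g] on [H], and [g ^+ 2] for the second order error of [K]. *)
Lemma stein_test_laplace :
  stein_test laplaceH laplaceK (fun l => - laplaceH l) (1 + g + g ^+ 2).
Proof.
have hg := g0.
have e01 l : 0 < expR (- g * Num.max l 0) <= 1.
  rewrite expR_gt0 /= -[leRHS]expR0 ler_expR mulNr oppr_le0 mulr_ge0//; first exact: ltW.
  by rewrite le_max lexx orbT.
have g20 : 0 <= g ^+ 2 by exact: sqr_ge0.
have hH l : 0 <= laplaceH l <= g.
  have /andP[e0 e1] := e01 l; rewrite /laplaceH mulr_ge0 ?(ltW g0) ?(ltW e0)//=.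
  by rewrite ler_piMr// ltW.
have mH := continuous_measurable_fun continuous_laplaceH.
split.
- split => //; first exact: (continuous_measurable_fun continuous_laplaceK).
  exact: measurableT_comp.
- move=> l; have /andP[h1 h2] := hH l; have /andP[e0 e1] := e01 l.
  split; rewrite ?normrN ler_norml; [lra|rewrite /laplaceK; lra|lra].
- move=> x y x0 xy; rewrite /laplaceK /laplaceH !max_l//; last exact: le_trans xy.
  have y0 : 0 <= y := le_trans x0 xy.
  set z := g * (y - x).
  have z0 : 0 <= z by rewrite mulr_ge0 ?(ltW g0) ?subr_ge0.
  have -> : - g * y = - g * x + - z by rewrite /z; ring.
  rewrite expRD.
  have -> : 1 - expR (- g * x) * expR (- z) - (1 - expR (- g * x)) -
    g * (expR (- g * x) * expR (- z)) * (y - x) =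
    expR (- g * x) * (1 - expR (- z) * (1 + z)) by rewrite /z; ring.
  have ex : 0 < expR (- g * x) <= 1 by have := e01 x; rewrite max_l.
  have l1 := expR_lower z.
  have l2 : 0 <= 1 - expR (- z) * (1 + z).
    by rewrite subr_ge0 expRN mulrC ler_pdivrMr ?expR_gt0// mul1r expR_ge1Dx.
  have l3 : 1 - expR (- z) * (1 + z) <= z ^+ 2.
    have : (1 - z) * (1 + z) <= expR (- z) * (1 + z) by rewrite ler_wpM2r//; lra.
    rewrite (_ : (1 - z) * (1 + z) = 1 - z ^+ 2); last by ring.
    lra.
  have /andP[ex0 ex1] := ex.
  rewrite ger0_norm; last by rewrite mulr_ge0// ltW.
  apply: (@le_trans _ _ (1 * z ^+ 2)); first by apply: ler_pM => //; exact: ltW.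
  rewrite mul1r /z exprMn ler_wpM2r ?sqr_ge0//; lra.
- move=> x y x0 xy; rewrite ler0_norm; first by rewrite opprB opprK addrC.
  rewrite subr_le0 /laplaceH ler_pM2l// ler_expR !mulNr lerN2 ler_pM2l//.
  by rewrite ge_max !le_max xy lexx orbT.
Qed.

End laplace_test.

Section tail_test.
Variables (m t eta : R) (m0 : 0 < m) (t0 : 0 <= t) (eta0 : 0 < eta).

(* [l |-> (low l, mid l)] splits the time [l] at [t] and [t + eta]. *)
Definition low (l : R) : R := Num.min (Num.max l 0) t.
Definition mid (l : R) : R := Num.min (Num.max (l - t) 0) eta.

Let E := expR (t / m).

Definition ease (r : R) : R := r - r ^+ 2 / (2 * eta).

(** With [H = expR (l / m)] up to [t] and 0 beyond, [H - K / m] would be [1 - E] times the indicator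
    of [l > t], and Stein's equation would give the tail. That [H] jumps at [t]; here it descends
    linearly from [E] to 0 on [[t, t + eta]], and [E * ease] is the integral of this descent. *)
Definition tailK (l : R) : R := m * (expR (low l / m) - 1) + E * ease (mid l).
Definition tailH (l : R) : R := expR (low l / m) - E * (mid l / eta).

Lemma tail_equation l :
  tailH l - tailK l / m = 1 - E * (mid l / eta + ease (mid l) / m).
Proof. by rewrite /tailH /tailK; field; rewrite !gt_eqF. Qed.

Lemma continuous_low : continuous low.
Proof.
move=> x; refine (@continuous_min R R (fun l => Num.max l 0) (fun=> t) x _ _).
  by apply: (@continuous_max _ _ id (fun=> 0)); [exact: cvg_id|exact: cvg_cst].
exact: cvg_cst.
Qed.

Lemma continuous_mid : continuous mid.
Proof.
move=> x; refine (@continuous_min R R (fun l => Num.max (l - t) 0) (fun=> eta) x _ _).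
  apply: (@continuous_max _ _ (fun l => l - t) (fun=> 0)); last exact: cvg_cst.
  by apply: cvgB; [exact: cvg_id|exact: cvg_cst].
exact: cvg_cst.
Qed.

Let continuous_explow : continuous (fun l => expR (low l / m)).
Proof.
move=> x; apply: continuous_comp; last exact: continuous_expR.
by apply: cvgM; [exact: continuous_low|exact: cvg_cst].
Qed.

Lemma continuous_tailH : continuous tailH.
Proof.
move=> x; apply: cvgB; first exact: continuous_explow.
apply: cvgM; first exact: cvg_cst.
by apply: cvgM; [exact: continuous_mid|exact: cvg_cst].
Qed.

Lemma continuous_tailK : continuous tailK.
Proof.
move=> x; apply: cvgD; apply: cvgM; try exact: cvg_cst.
  by apply: cvgB; [exact: continuous_explow|exact: cvg_cst].
apply: cvgB; first exact: continuous_mid.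
apply: cvgM; last exact: cvg_cst.
by apply: cvgX || (apply: cvgM; exact: continuous_mid).
Qed.

Lemma low_midP l : 0 <= l ->
  [\/ [/\ l <= t, low l = l & mid l = 0],
      [/\ t <= l <= t + eta, low l = t & mid l = l - t] |
      [/\ t + eta <= l, low l = t & mid l = eta]].
Proof.
have ht := t0; have he := eta0; move=> l0; rewrite /low /mid (max_l l0).
have [lt|tl] := leP l t.
  apply: Or31; split => //.
  by rewrite max_r ?subr_le0// min_l// ltW.
have lt0 : 0 <= l - t by rewrite subr_ge0 ltW.
rewrite (max_l lt0).
have [h|h] := leP (l - t) eta.
  by apply: Or32; split => //; apply/andP; split; lra.
by apply: Or33; split => //; lra.
Qed.

(** An increment of [l] splits into parts spent before [t], in [[t, t + eta]] and after. A part can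
    only be positive if [x] has not passed its zone or [y] has reached it. *)
Lemma low_mid_split x y : 0 <= x -> x <= y ->
  [/\ low x <= low y <= t /\ mid x <= mid y <= eta,
      (low y - low x) + (mid y - mid x) <= y - x,
      (low x < low y -> mid x = 0),
      (mid x < mid y -> low y = t) &
      ((low y - low x) + (mid y - mid x) < y - x -> low y = t /\ mid y = eta)].
Proof.
move=> x0 xy; have y0 : 0 <= y := le_trans x0 xy.
have ht := t0; have he := eta0.
by case: (low_midP x0) => -[x1 -> ->]; case: (low_midP y0) => -[y1 -> ->];
  split; try (by move=> ?; split; lra); try (by move=> ?; lra);
  try (by split; apply/andP; split; lra); lra.
Qed.

Lemma expR_div_lip p q : 0 <= p -> p <= q -> q <= t ->
  0 <= expR (q / m) - expR (p / m) <= E / m * (q - p) /\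
  `|m * (expR (q / m) - expR (p / m)) - expR (q / m) * (q - p)|
    <= E / m * (q - p) ^+ 2.
Proof.
have hm := m0; move=> p0 pq qt.
pose z := (q - p) / m.
have z0 : 0 <= z by rewrite divr_ge0// ?subr_ge0// ltW.
have qpz : q - p = m * z by rewrite /z; field; lra.
have -> : expR (p / m) = expR (q / m) * expR (- z).
  by rewrite -expRD; congr expR; rewrite /z; field; lra.
have l1 := expR_lower z; have l2 := expR_upper z0.
have l3 : expR (- z) <= 1 by rewrite -[leRHS]expR0 ler_expR oppr_le0.
have eq0 : 0 < expR (q / m) by exact: expR_gt0.
have eqE : expR (q / m) <= E by rewrite ler_expR ler_pM2r ?invr_gt0.
have -> : expR (q / m) - expR (q / m) * expR (- z) = expR (q / m) * (1 - expR (- z)) by ring.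
have -> : E / m * (q - p) = E * z by rewrite qpz; field; lra.
have -> : E / m * (q - p) ^+ 2 = m * (E * z ^+ 2) by rewrite qpz; field; lra.
split.
  apply/andP; split; first by apply: mulr_ge0; [exact: ltW|lra].
  by apply: ler_pM; [exact: ltW|lra|by []|lra].
rewrite qpz (_ : _ - _ = - (m * (expR (q / m) * (expR (- z) - (1 - z))))); last by ring.
rewrite normrN ger0_norm; last first.
  by apply: mulr_ge0; [exact: ltW|apply: mulr_ge0; [exact: ltW|lra]].
rewrite ler_pM2l//; apply: ler_pM; [exact: ltW|lra|by []|lra].
Qed.

Lemma ease_ge0 r : 0 <= r <= eta -> 0 <= ease r <= r.
Proof.
have he := eta0; move=> /andP[r0 re]; rewrite /ease.
have : 0 <= r ^+ 2 / (2 * eta) <= r.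
  rewrite divr_ge0 ?sqr_ge0//=; last by lra.
  rewrite ler_pdivrMr; last by lra.
  by rewrite expr2; nra.
by move=> /andP[? ?]; apply/andP; split; lra.
Qed.

Lemma low_itv l : 0 <= low l <= t.
Proof.
by rewrite /low le_min le_max lexx orbT t0 /= ge_min lexx orbT.
Qed.

Lemma mid_itv l : 0 <= mid l <= eta.
Proof.
by rewrite /mid le_min le_max lexx orbT (ltW eta0) /= ge_min lexx orbT.
Qed.

Lemma expR_low_itv l : 1 <= expR (low l / m) <= E.
Proof.
have hm := m0; have /andP[h1 h2] := low_itv l.
rewrite -[X in X <= _]expR0 !ler_expR ler_pM2r ?invr_gt0// h2 andbT.
by rewrite divr_ge0// ltW.
Qed.

(** [tailH] is Lipschitz in [low] and [mid], which are nondecreasing; a multiple of their sum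
    therefore dominates its variation. *)
Definition tailB (l : R) : R := (E / m + E / eta) * (low l + mid l).

Definition tailC : R := E + m * E + E * eta + (E / m + E / eta) * (t + eta)
  + (E / m + 2 * (E / eta)).

Lemma stein_test_tail : stein_test tailH tailK tailB tailC.
Proof.
have hm := m0; have he := eta0; have ht := t0.
have E0 : 0 < E by exact: expR_gt0.
have Em0 : 0 < E / m by rewrite divr_gt0.
have Ee0 : 0 < E / eta by rewrite divr_gt0.
have mE0 : 0 < m * E by rewrite mulr_gt0.
have Eeta0 : 0 < E * eta by rewrite mulr_gt0.
have L0 : 0 <= (E / m + E / eta) * (t + eta) by apply: mulr_ge0; lra.
split.
- split; first exact: (continuous_measurable_fun continuous_tailH).
    exact: (continuous_measurable_fun continuous_tailK).
  apply: measurable_funM => //; apply: measurable_funD.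
    exact: (continuous_measurable_fun continuous_low).
  exact: (continuous_measurable_fun continuous_mid).
- move=> l; have /andP[l1 l2] := low_itv l; have /andP[m1 m2] := mid_itv l.
  have /andP[e1 e2] := expR_low_itv l.
  have me : 0 <= mid l / eta <= 1.
    by rewrite divr_ge0 ?(ltW he)//= ler_pdivrMr// mul1r.
  move: me => /andP[me1 me2].
  have /andP[s1 s2] := ease_ge0 (mid_itv l).
  split.
  + have : 0 <= E * (mid l / eta) <= E * 1 by rewrite mulr_ge0 ?(ltW E0)//= ler_pM2l.
    by move=> /andP[? ?]; rewrite /tailH /tailC ler_norml; apply/andP; split; lra.
  + have h1 : 0 <= m * (expR (low l / m) - 1) <= m * E.
      by apply/andP; split; [apply: mulr_ge0; lra|rewrite ler_pM2l//; lra].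
    have h2 : 0 <= E * ease (mid l) <= E * eta.
      by apply/andP; split; [apply: mulr_ge0; lra|rewrite ler_pM2l//; lra].
    move: h1 h2 => /andP[? ?] /andP[? ?].
    by rewrite /tailK /tailC ler_norml; apply/andP; split; lra.
  + have h : 0 <= tailB l <= (E / m + E / eta) * (t + eta).
      rewrite /tailB mulr_ge0/=; [|lra|lra].
      by apply: ler_wpM2l; lra.
    move: h => /andP[? ?].
    by rewrite /tailC ler_norml; apply/andP; split; lra.
- move=> x y x0 xy.
  have [[/andP[x1y1 y1t] /andP[x2y2 y2e]] uvs hu hv hs] := low_mid_split x0 xy.
  have /andP[x10 _] := low_itv x; have /andP[x20 _] := mid_itv x.
  (* The Taylor error is estimated zone by zone: it vanishes after [t + eta], where [H] is 0 ([T3]),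
     is an exact square in the descent ([T2]), and before [t] gains the cross term [v * u] because
     [H] is taken at [y] ([T1]). *)
  have [_ lip] := expR_div_lip x10 x1y1 y1t.
  pose u := low y - low x; pose v := mid y - mid x; pose s := y - x.
  have u0 : 0 <= u by rewrite subr_ge0.
  have v0 : 0 <= v by rewrite subr_ge0.
  have T3 : tailH y * (s - u - v) = 0.
    move: uvs; rewrite le_eqVlt => /orP[/eqP e|/hs[e1 e2]].
      by rewrite -/u -/v -/s in e; rewrite -e; ring.
    rewrite /tailH e1 e2 divff ?gt_eqF//; rewrite /E; ring.
  have T2 : E * (ease (mid y) - ease (mid x)) - tailH y * v = E * (v ^+ 2 / (2 * eta)).
    move: x2y2; rewrite le_eqVlt => /orP[/eqP e|/hv e].
      by rewrite /v e; ring.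
    by rewrite /tailH e -/E /ease /v; field; lra.
  have T1 : `|m * (expR (low y / m) - expR (low x / m)) - tailH y * u| <=
      E / m * u ^+ 2 + E / eta * (v * u).
    move: x1y1; rewrite le_eqVlt => /orP[/eqP e|/hu e].
      by rewrite /u e !subrr !mulr0 subrr normr0 expr0n /= !mulr0 addr0.
    have vy : v = mid y by rewrite /v e subr0.
    have -> : m * (expR (low y / m) - expR (low x / m)) - tailH y * u =
      m * (expR (low y / m) - expR (low x / m)) - expR (low y / m) * u +
      E / eta * (v * u) by rewrite /tailH vy; ring.
    apply: (le_trans (ler_normD _ _)); apply: lerD => //.
    by rewrite ger0_norm// mulr_ge0 ?(ltW Ee0)// mulr_ge0.
  have -> : tailK y - tailK x - tailH y * (y - x) =
    (m * (expR (low y / m) - expR (low x / m)) - tailH y * u) +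
    (E * (ease (mid y) - ease (mid x)) - tailH y * v) - tailH y * (s - u - v).
    by rewrite /tailK /s; ring.
  rewrite T3 T2 subr0.
  apply: (le_trans (ler_normD _ _)).
  have uvs' : u + v <= s := uvs.
  have su : u <= s by lra.
  have sv : v <= s by lra.
  have s0 : 0 <= s by lra.
  have us : u ^+ 2 <= s ^+ 2 by rewrite ler_sqr ?nnegrE.
  have vs : v ^+ 2 <= s ^+ 2 by rewrite ler_sqr ?nnegrE.
  have vus : v * u <= s ^+ 2 by rewrite expr2; apply: ler_pM.
  have s20 : 0 <= s ^+ 2 by exact: sqr_ge0.
  have P1 : E / m * u ^+ 2 <= E / m * s ^+ 2 by rewrite ler_pM2l.
  have P2 : E / eta * (v * u) <= E / eta * s ^+ 2 by rewrite ler_pM2l.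
  have P3 : `|E * (v ^+ 2 / (2 * eta))| <= E / eta * s ^+ 2.
    have -> : E * (v ^+ 2 / (2 * eta)) = E / eta * (v ^+ 2 / 2) by field; lra.
    have v20 : 0 <= v ^+ 2 by exact: sqr_ge0.
    rewrite ger0_norm; first by rewrite ler_pM2l//; lra.
    by apply: mulr_ge0; [exact: ltW|lra].
  rewrite -/s /tailC [leRHS]mulrDl.
  have Q0 : 0 <= (E + m * E + E * eta + (E / m + E / eta) * (t + eta)) * s ^+ 2.
    by apply: mulr_ge0 => //; lra.
  have -> : (E / m + 2 * (E / eta)) * s ^+ 2 = E / m * s ^+ 2 + E / eta * s ^+ 2
    + E / eta * s ^+ 2 by ring.
  apply: (le_trans (lerD T1 P3)); lra.
- move=> x y x0 xy.
  have [[/andP[x1y1 y1t] /andP[x2y2 y2e]] _ _ _ _] := low_mid_split x0 xy.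
  have /andP[x10 _] := low_itv x.
  have [/andP[p1 p2] _] := expR_div_lip x10 x1y1 y1t.
  have -> : tailH y - tailH x = (expR (low y / m) - expR (low x / m)) -
     E / eta * (mid y - mid x) by rewrite /tailH; ring.
  have v0 : 0 <= mid y - mid x by rewrite subr_ge0.
  have u0 : 0 <= low y - low x by rewrite subr_ge0.
  apply: (le_trans (ler_normB _ _)).
  rewrite (ger0_norm p1) (ger0_norm (mulr_ge0 (ltW Ee0) v0)).
  have q1 : 0 <= E / m * (mid y - mid x) by rewrite mulr_ge0// ltW.
  have q2 : 0 <= E / eta * (low y - low x) by rewrite mulr_ge0// ltW.
  rewrite /tailB; lra.
Qed.

End tail_test.

End stein_tests.

(** * The law of the local time at exit *)

Section integral_ae.
Context d (T : measurableType d) (R : realType) (P : {measure set T -> \bar R}).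
Implicit Types f g : T -> \bar R.

(** The integral of a nonnegative function is a supremum over the simple functions below it, hence
    monotone without any measurability. *)
Lemma le_integral_ge0 f g : (forall t, 0 <= f t)%E -> (forall t, f t <= g t)%E ->
  (\int[P]_t f t <= \int[P]_t g t)%E.
Proof.
move=> f0 fg; have g0 t : (0 <= g t)%E := le_trans (f0 t) (fg t).
rewrite !ge0_integralTE//; apply: le_ereal_sup => _ [h hf <-].
by exists h => // t; exact: le_trans (hf t) (fg t).
Qed.

(** [f] lies between two measurable functions equal to [g] outside the null set [N], taking there
    the values 0 and [+oo]. *)
Lemma integral_ae_ge0 f g : (forall t, 0 <= f t)%E -> (forall t, 0 <= g t)%E ->
  measurable_fun setT g -> {ae P, forall t, f t = g t} ->
  (\int[P]_t f t = \int[P]_t g t)%E.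
Proof.
move=> f0 g0 mg [N [mN PN hN]].
have fN t : ~ N t -> f t = g t.
  by move=> nN; apply: contrapT => h; apply: nN; exact: hN.
pose lo t := if t \in N then 0%E else g t.
pose hi t := if t \in N then +oo%E else g t.
have mb : measurable_fun setT (fun t => t \in N).
  apply: (measurable_fun_bool true).
  rewrite (_ : _ @^-1` _ = N) ?setTI//.
  by apply/seteqP; split => t /=; [move=> /set_mem|move=> /mem_set].
have mlo : measurable_fun setT lo by exact: measurable_fun_ifT.
have mhi : measurable_fun setT hi by exact: measurable_fun_ifT.
have out t : ~ N t -> (t \in N) = false by move=> nN; apply/negbTE; rewrite notin_setE.
have ae1 (u : T -> \bar R) : (forall t, ~ N t -> u t = g t) -> {ae P, forall t, setT t -> u t = g t}.
  move=> ug; exists N; split => // t /= nt; apply: contrapT => nN; apply: nt => _.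
  exact: ug.
apply/eqP; rewrite eq_le; apply/andP; split.
  have <- : (\int[P]_t hi t = \int[P]_t g t)%E.
    by apply: ae_eq_integral => //; apply: ae1 => t nN; rewrite /hi out.
  apply: le_integral_ge0 => // t; rewrite /hi; case: ifPn; first by rewrite leey.
  by rewrite notin_setE => /fN ->.
have <- : (\int[P]_t lo t = \int[P]_t g t)%E.
  by apply: ae_eq_integral => //; apply: ae1 => t nN; rewrite /lo out.
apply: le_integral_ge0 => t; rewrite /lo; case: ifPn => //.
by rewrite notin_setE => /fN ->.
Qed.

(** Transfers expectations from the measurable version to the local time at exit, which is a random
    variable only up to a null set. *)
Lemma integral_ae_unmeasurable f g : measurable_fun setT g ->
  {ae P, forall t, f t = g t} -> (\int[P]_t f t = \int[P]_t g t)%E.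
Proof.
move=> mg fg; rewrite integralE [RHS]integralE; congr (_ - _)%E.
  apply: integral_ae_ge0 => //; first exact: measurable_funepos.
  by apply: filterS fg => t e; rewrite !unlock e.
apply: integral_ae_ge0 => //; first exact: measurable_funeneg.
by apply: filterS fg => t e; rewrite !unlock e.
Qed.

End integral_ae.

Section exponential_law.
Context {R : realType}.

Lemma exponential_prob_tail (r t : R) : 0 < r -> 0 <= t ->
  exponential_prob r `]t, +oo[ = (expR (- r * t))%:E.
Proof.
move=> r0 t0; rewrite /exponential_prob integral_itv_obnd_cbnd; last first.
  apply/measurable_EFinP; apply: measurable_funTS.
  exact: measurable_exponential_pdf.
rewrite (@ge0_continuous_FTC2y _ _ (fun x => - (expR (- r * x))) _ 0)//.
- by rewrite EFinN oppeK add0e.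
- by move=> x _; apply: exponential_pdf_ge0; exact: ltW.
- apply: (@continuous_subspaceW R^o _ _ [set` `[0, +oo[%R]).
  + by apply: subset_itvr; rewrite bnd_simp.
  + exact: within_continuous_exponential_pdf.
- rewrite -oppr0; apply: cvgN.
  rewrite (_ : (fun x => expR (- r * x)) =
               (fun z => expR (- z)) \o (fun z => r * z)); last first.
    by apply/funext => x; rewrite /= mulNr.
  apply: (@cvg_comp _ _ _ _ _ _ (pinfty_nbhs R)); last exact: cvgr_expR.
  exact: gt0_cvgMry.
- apply: cvgN; apply/cvg_at_right_filter.
  apply: continuous_comp; last exact: continuous_expR.
  by apply: cvgM; [exact: cvg_cst|exact: cvg_id].
- move=> x; rewrite in_itv /= andbT => tx; apply: derive1_exponential_pdf.
  by rewrite in_itv /= andbT (le_lt_trans t0).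
Qed.

(** Open right rays generate the Borel sets and are stable under intersection. For [x < 0] both
    measures of the ray are 1, because they already are for []0, +oo[]. *)
Lemma exponential_law_unique (nu : probability (measurableTypeR R) R) (r : R) :
  0 < r -> (forall t, 0 <= t -> nu `]t, +oo[%classic = (expR (- r * t))%:E) ->
  forall B, measurable B -> nu B = exponential_prob r B.
Proof.
move=> r0 H.
have @E : probability (measurableTypeR R) R by refine (exponential_prob r).
have tail1 (p : probability (measurableTypeR R) R) x :
    p `]0, +oo[%classic = 1%E -> x < 0 -> p `]x, +oo[%classic = 1%E.
  move=> p1 x0; apply/eqP; rewrite eq_le probability_le1//= -p1.
  apply: le_measure; rewrite ?inE//.
  by apply: subset_itvr; rewrite bnd_simp ltW.
have EH t : 0 <= t -> E `]t, +oo[%classic = (expR (- r * t))%:E.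
  by move=> ?; exact: exponential_prob_tail.
have one (p : probability (measurableTypeR R) R) :
    (forall t, 0 <= t -> p `]t, +oo[%classic = (expR (- r * t))%:E) ->
    p `]0, +oo[%classic = 1%E.
  by move=> ->//; rewrite mulr0 expR0.
move=> B mB; change (nu B = E B).
refine (@measure_unique _ R (measurableTypeR R) (@RGenOInfty.G R)
  (fun n => `](- n%:R)%R, +oo[%classic) _ _ _ _ nu E _ _ B mB).
- exact: RGenOInfty.measurableE.
- move=> _ _ [x ->] [y ->]; exists (Num.max x y).
  apply/seteqP; split => z /=; rewrite !in_itv /= !andbT gt_max.
    by move=> [-> ->].
  by move=> /andP[].
- by move=> n; exists (- n%:R).
- apply/seteqP; split => // z _; exists (Num.truncn `|z|).+1 => //=.
  rewrite in_itv /= andbT ltrNl (le_lt_trans _ (truncnS_gt _))//.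
  by rewrite -normrN ler_norm.
- move=> _ [x ->]; have [x0|x0] := leP 0 x.
    exact: etrans (H x x0) (esym (EH x x0)).
  exact: etrans (tail1 nu x (one nu H) x0) (esym (tail1 E x (one E EH) x0)).
- by move=> n; rewrite (le_lt_trans (probability_le1 _ _)) ?ltry.
Qed.

End exponential_law.

Section exit_law.
Context d (T : measurableType d) (R : realType) (P : probability T R).
Variables (w : R -> {RV P >-> R}) (L : R -> T -> R) (a b : R).
Hypotheses (a0 : a < 0) (b0 : 0 < b).
Hypothesis hw : standard_brownian_motion P w.
Hypothesis hL : is_local_time0 P w L.
Variable Y : {RV P >-> R}.
Hypothesis Y0 : forall t, 0 <= Y t.
Hypothesis YL : {ae P, forall t, Y t = local_time_at_exit w L a b t}.

Local Notation m := (exit_mean a b).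

Let m0 : 0 < m := exit_mean_gt0 a0 b0.

(** Stein's equation for [laplaceH] reads [(g + m^-1) * I = m^-1], where [I] is the integral
    sought. *)
Lemma laplace_local_time (g : R) : 0 < g ->
  \int[P]_t expR (- g * Y t) = 1 / (1 + m * g).
Proof.
move=> g0; have hm := m0.
have := stein_identity a0 b0 hw hL YL (stein_test_laplace g0)
  (continuous_laplaceH (g := g)) (continuous_laplaceK (g := g)).
have -> : laplaceK g 0 = 0 by rewrite /laplaceK maxxx mulr0 expR0 subrr.
rewrite oppr0 mul0r.
have mE : measurable_fun setT (fun t => expR (- g * Y t)).
  by apply: measurableT_comp => //; exact: measurable_funM.
have iE : P.-integrable setT (EFin \o (fun t => expR (- g * Y t))).
  apply: (@integrable_bounded _ _ _ P _ 1) => // t.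
  rewrite ger0_norm ?expR_ge0// -[leRHS]expR0 ler_expR mulNr oppr_le0 mulr_ge0//.
  exact: ltW.
rewrite (@eq_Rintegral _ _ _ P setT (fun t => (g + m^-1) * expR (- g * Y t) - m^-1)); last first.
  by move=> t _; rewrite /laplaceH /laplaceK max_l//; ring.
rewrite RintegralB//; last 2 first.
- have := integrableZl measurableT (g + m^-1) iE.
  by apply: eq_integrable => // x _; rewrite /= EFinM.
- exact: finite_measure_integrable_cst.
rewrite RintegralZl// Rintegral_prob_cst.
set I := \int[P]_t _ => h.
have gm : 0 < m * g by rewrite mulr_gt0.
have h2 : I * (1 + m * g) = 1.
  have -> : I * (1 + m * g) = m * ((g + m^-1) * I - m^-1) + 1 by field; lra.
  by rewrite h mulr0 add0r.
have gm1 : 1 + m * g != 0 by lra.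
by apply: (mulIf gm1); rewrite h2 divfK.
Qed.

Let ptail (t : R) : R := fine (P (Y @^-1` `]t, +oo[%classic)).

Let mY (B : set R) : measurable B -> measurable (Y @^-1` B).
Proof. by move=> mB; rewrite -[X in measurable X]setTI; exact: measurable_funP. Qed.

Let ptail_le1 t : ptail t <= 1.
Proof.
rewrite -lee_fin fineK; last by apply: fin_num_measure; exact: mY.
by apply: probability_le1; exact: mY.
Qed.

Let tail_fun (t eta : R) (x : T) : R :=
  mid t eta (Y x) / eta + ease eta (mid t eta (Y x)) / m.

Let measurable_tail_fun t eta : measurable_fun setT (tail_fun t eta).
Proof.
have mm : measurable_fun setT (fun x => mid t eta (Y x)).
  apply: (measurableT_comp (f := mid t eta)) => //.
  exact: (continuous_measurable_fun (@continuous_mid _ t eta)).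
apply: measurable_funD; apply: measurable_funM => //.
apply: measurable_funB => //; apply: measurable_funM => //.
exact: measurable_funX.
Qed.

Let tail_fun_ge0 t eta x : 0 < eta -> 0 <= tail_fun t eta x.
Proof.
move=> eta0; have /andP[m1 m2] := mid_itv t eta0 (Y x).
have /andP[e1 e2] := ease_ge0 eta0 (mid_itv t eta0 (Y x)).
by rewrite addr_ge0// divr_ge0// ltW// m0.
Qed.

Let tail_fun_le t eta : 0 < eta -> forall x, `|tail_fun t eta x| <= 1 + eta / m.
Proof.
move=> eta0 x; have hm := m0; have /andP[m1 m2] := mid_itv t eta0 (Y x).
have /andP[e1 e2] := ease_ge0 eta0 (mid_itv t eta0 (Y x)).
rewrite ger0_norm; last exact: tail_fun_ge0.
apply: lerD; first by rewrite ler_pdivrMr// mul1r.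
by rewrite ler_pM2r ?invr_gt0//; lra.
Qed.

Lemma stein_tail (t eta : R) : 0 <= t -> 0 < eta ->
  \int[P]_x (mid t eta (Y x) / eta + ease eta (mid t eta (Y x)) / m) = expR (- (t / m)).
Proof.
move=> t0 eta0; have hm := m0.
have := stein_identity a0 b0 hw hL YL (stein_test_tail m0 t0 eta0)
  (@continuous_tailH _ m t eta) (@continuous_tailK _ m t eta).
have mid0 : mid t eta 0 = 0.
  by rewrite /mid max_r ?sub0r ?oppr_le0// min_l// ltW.
have -> : tailK m t eta 0 = 0.
  by rewrite /tailK /low maxxx min_l// mid0 mul0r expR0 /ease; ring.
rewrite oppr0 mul0r; set q := fun x => mid t eta (Y x) / eta + _.
have iq := integrable_bounded P (measurable_tail_fun t eta) (tail_fun_le t eta0).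
rewrite (@eq_Rintegral _ _ _ P setT (fun x => 1 - expR (t / m) * q x)); last first.
  by move=> x _; rewrite tail_equation.
rewrite RintegralB//; last 2 first.
- exact: finite_measure_integrable_cst.
- have := integrableZl measurableT (expR (t / m)) iq.
  by apply: eq_integrable => // x _; rewrite /= EFinM.
rewrite RintegralZl// Rintegral_prob_cst => h.
rewrite expRN; have e0 := expR_gt0 (t / m).
have -> : \int[P]_x q x = (1 - (1 - expR (t / m) * \int[P]_x q x)) / expR (t / m).
  by field; lra.
by rewrite h subr0 mul1r.
Qed.

Let Rintegral_indicator (A : set T) : measurable A -> \int[P]_x (\1_A x : R) = fine (P A).
Proof. by move=> mA; rewrite /Rintegral integral_indic// setIT. Qed.

(** The integrand of [stein_tail] at [(t, eta)] is at most [1 + eta / m] times the indicator of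
    [Y > t], which bounds the tail from below; at [(t - eta, eta)] it dominates this indicator,
    which bounds it from above. *)
Lemma local_time_tail (t : R) : 0 <= t -> P (Y @^-1` `]t, +oo[%classic) = (expR (- (t / m)))%:E.
Proof.
move=> t0; have hm := m0.
rewrite -[LHS]fineK ?fin_num_measure//; last exact: mY.
congr (_%:E); rewrite -/(ptail t); apply/eqP; rewrite eq_le; apply/andP; split.
- apply/ler_addgt0Pr => e e0.
  (* At [t = 0] the shift to [t - eta] is impossible, but the bound is just that a probability is at
     most 1. *)
  have [->|tn0] := eqVneq t 0.
    rewrite mul0r oppr0 expR0.
    have := ptail_le1 0; lra.
  have tp : 0 < t by rewrite lt_neqAle eq_sym tn0.
  pose eta := Num.min t (e * m).
  have eta0 : 0 < eta by rewrite lt_min tp mulr_gt0.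
  have etat : eta <= t by rewrite ge_min lexx.
  have etae : eta / m <= e by rewrite ler_pdivrMr// ge_min lexx orbT.
  have te0 : 0 <= t - eta by rewrite subr_ge0.
  have := stein_tail te0 eta0; set q := fun x => _ + _ => hq.
  have pq : ptail t <= expR (- ((t - eta) / m)).
    rewrite -hq /ptail -Rintegral_indicator; last exact: mY.
    apply: le_Rintegral => //.
    + apply: (@integrable_bounded _ _ _ P _ 1).
        by apply: measurable_indic; exact: mY.
      by move=> x; rewrite indicE; case: (_ \in _); rewrite ?normr1 ?normr0.
    + exact: (integrable_bounded P (measurable_tail_fun (t - eta) eta) (tail_fun_le (t - eta) eta0)).
    + move=> x _; rewrite indicE; have [xt|_] := boolP (_ \in _); last exact: tail_fun_ge0.
      have tY : t < Y x by move: xt; rewrite inE /= in_itv /= andbT.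
      have -> : mid (t - eta) eta (Y x) = eta.
        rewrite /mid max_l; last by lra.
        by rewrite min_r//; lra.
      have ee : 0 <= eta <= eta by rewrite lexx ltW.
      have /andP[ea _] := ease_ge0 eta0 ee.
      by rewrite divff ?gt_eqF// lerDl divr_ge0 ?(ltW hm).
  rewrite (_ : - ((t - eta) / m) = - (t / m) + eta / m) in pq; last by field; lra.
  have et1 : 0 <= t / m by rewrite divr_ge0// ltW.
  have E1 : expR (- (t / m)) <= 1 by rewrite -[leRHS]expR0 ler_expR oppr_le0.
  have p1 := ptail_le1 t.
  rewrite expRD in pq; set c := expR (- (t / m)) in pq E1 *.
  have c0 : 0 < c by exact: expR_gt0.
  have p0 : 0 <= ptail t by rewrite fine_ge0.
  have l1 := expR_lower (eta / m).
  have e1 : ptail t * expR (- (eta / m)) <= c.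
    rewrite -(@ler_pM2r _ (expR (eta / m))) ?expR_gt0//.
    by rewrite -mulrA -expRD addNr expR0 mulr1.
  have e2 : ptail t * (1 - eta / m) <= ptail t * expR (- (eta / m)) by rewrite ler_wpM2l.
  have e3 : ptail t * (eta / m) <= 1 * e by apply: ler_pM => //; rewrite divr_ge0// ltW.
  lra.
- apply/ler_addgt0Pr => e e0.
  pose eta := e * m.
  have eta0 : 0 < eta by rewrite mulr_gt0.
  rewrite -(stein_tail t0 eta0); set q := fun x => _ + _.
  have em : eta / m = e by rewrite /eta mulfK//; lra.
  have iI : P.-integrable setT (EFin \o (\1_(Y @^-1` `]t, +oo[%classic) : T -> R)).
    apply: (@integrable_bounded _ _ _ P _ 1).
      by apply: measurable_indic; exact: mY.
    by move=> x; rewrite indicE; case: (_ \in _); rewrite ?normr1 ?normr0.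
  apply: (@le_trans _ _ (\int[P]_x ((1 + e) * (\1_(Y @^-1` `]t, +oo[%classic) x : R)))).
    apply: le_Rintegral => //.
    + exact: (integrable_bounded P (measurable_tail_fun t eta) (tail_fun_le t eta0)).
    + have := integrableZl measurableT (1 + e) iI.
      by apply: eq_integrable => // x _; rewrite /= EFinM.
    + move=> x _; rewrite indicE; have [xt|xt] := boolP (_ \in _).
        by rewrite mulr1; apply: (le_trans (ler_norm _)); rewrite -em; exact: tail_fun_le.
      have -> : mid t eta (Y x) = 0.
        move: xt; rewrite notin_setE /= in_itv /= andbT => /negP; rewrite -leNgt => xt.
        by rewrite /mid max_r ?subr_le0// min_l// ltW.
      by rewrite /ease !mul0r expr0n /= !mul0r subrr mul0r addr0 mulr0.
  rewrite RintegralZl// Rintegral_indicator; last exact: mY.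
  rewrite -/(ptail t).
  have p1 := ptail_le1 t.
  have p0 : 0 <= ptail t by rewrite fine_ge0.
  have : e * ptail t <= e * 1 by rewrite ler_pM2l.
  lra.
Qed.

End exit_law.

Unset Implicit Arguments.
Set Strict Implicit.

(* [fine] sends +oo to 0; this only concerns paths that never hit {a, b}. *)
Theorem mainTheorem2 (R : realType) (d : measure_display)
    (T : measurableType d) (P : probability T R)
    (w : R -> {RV P >-> R}) (L : R -> T -> R) (a b : R)
    (ha : a < 0) (hb : 0 < b)
    (hw : standard_brownian_motion P w)
    (hL : is_local_time0 P w L) :
  let L_tau := fun x : T => L (fine (hitting_time w a b x)) x in
  let mean := 2 * (- a) * b / (b - a) in
  [/\ forall gamma : R, 0 < gamma ->
        'E_P[fun x => expR (- gamma * L_tau x)%R]%E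
        = (1 / (1 + mean * gamma))%:E,
      has_law P L_tau (exponential_prob mean^-1),
      'E_P[L_tau]%E = mean%:E
    & a = - b -> 'E_P[L_tau]%E = b%:E].
Proof.
move=> L_tau mean.
have m0 : 0 < mean := exit_mean_gt0 ha hb.
have [Y Y0 YL] := ae_local_time_RV ha hb hw hL.
have EL : 'E_P[L_tau]%E = mean%:E.
  transitivity ('E_P[Y])%E.
    rewrite unlock; apply: integral_ae_unmeasurable.
      exact/measurable_EFinP.
    by apply: filterS YL => t ->.
  (* The mean is the integral of the tail, and the tail is [mean] times the exponential density,
     whose total mass is 1. *)
  rewrite ge0_expectation_ccdf//.
  transitivity (\int[lebesgue_measure]_(r in `[0%R, +oo[)
      (mean%:E * (exponential_pdf mean^-1 r)%:E))%E.
    apply: eq_integral => r; rewrite inE /= in_itv /= andbT => r0.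
    rewrite exponential_pdfE// -EFinM mulrA divff ?gt_eqF// mul1r.
    rewrite /ccdf /distribution /pushforward (local_time_tail ha hb hw hL YL r0).
    by congr (expR _)%:E; rewrite mulNr mulrC.
  have mpdf : measurable_fun (`[0, +oo[%classic : set R) (EFin \o exponential_pdf mean^-1).
    by apply/measurable_EFinP; apply: measurable_funTS; exact: measurable_exponential_pdf.
  have im0 : 0 < mean^-1 by rewrite invr_gt0.
  rewrite ge0_integralZl//; last 2 first.
    by move=> x _; rewrite lee_fin exponential_pdf_ge0// ltW.
    by rewrite lee_fin ltW.
  rewrite -integral_itv_obnd_cbnd; last first.
    by apply/measurable_EFinP; apply: measurable_funTS; exact: measurable_exponential_pdf.
  have := exponential_prob_tail im0 (lexx 0).
  by rewrite /exponential_prob mulr0 expR0 => ->; rewrite mule1.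
split.
- move=> g g0.
  have mE : measurable_fun setT (fun t => expR (- g * Y t)).
    by apply: measurableT_comp => //; exact: measurable_funM.
  transitivity (\int[P]_t (expR (- g * Y t))%:E)%E.
    rewrite unlock; apply: integral_ae_unmeasurable.
      exact/measurable_EFinP.
    by apply: filterS YL => t ->.
  rewrite -[mean]/(exit_mean a b) -(laplace_local_time ha hb hw hL Y0 YL g0).
  rewrite /Rintegral fineK//; apply: integrable_fin_num => //.
  apply: (@integrable_bounded _ _ _ P _ 1) => // t.
  rewrite ger0_norm ?expR_ge0// -[leRHS]expR0 ler_expR mulNr oppr_le0 mulr_ge0//.
  exact: ltW.
- exists Y => // B mB.
  have im0 : 0 < mean^-1 by rewrite invr_gt0.
  have tail t : 0 <= t -> distribution P Y `]t, +oo[%classic = (expR (- mean^-1 * t))%:E.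
    move=> t0; rewrite mulNr [_ * t]mulrC.
    exact: (local_time_tail ha hb hw hL YL t0).
  have mY : @measurable_fun _ _ T (measurableTypeR R) setT Y.
    have mY : measurable_fun setT Y by [].
    exact: mY.
  pose Y' : {mfun T >-> measurableTypeR R} :=
    HB.pack (Y : T -> measurableTypeR R) (isMeasurableFun.Build _ _ _ _ _ mY).
  exact: (exponential_law_unique (nu := distribution P Y') im0 tail mB).
- exact: EL.
- move=> ab; rewrite EL; congr (_%:E); rewrite /mean ab; field; lra.
Qed.
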